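(* Let $\lambda$ be a partition. In the algebra $\mathcal{U}/I_3^{\mathrm{Lam}}$, the noncommutative Schur function $\mathfrak{J}_\lambda(\mathbf{u})$ is equal to the following positive sum of monomials: $$\mathfrak{J}_\lambda(\mathbf{u})=\sum_{T\in \mathrm{RSST}_\lambda}\mathrm{sqread}(T).$$
   Context: **Algebra.** Let $\mathbf{A}=\mathbb{Q}[\hat q,\hat q^{-1}]$ and $q=\hat q^{-2}$. $\mathcal{U}$ is the free associative $\mathbf{A}$-algebra on noncommuting variables $u_i$, $i\in\mathbb{Z}$; its monomials are identified with words in the alphabet $\mathbb{Z}$ (the letter $n$ stands for $u_n$). For $k\ge 1$, $\mathcal{U}/I_k^{\mathrm{Lam}}$ is the quotient of $\mathcal{U}$ by the two-sided ideal $I_k^{\mathrm{Lam}}$ generated by the relations: $u_i^2=0$, $u_{i+k}u_iu_{i+k}=0$, $u_iu_{i+k}u_i=0$ for $i\in\mathbb{Z}$; $u_iu_j=u_ju_i$ for $|i-j|>k$; $u_iu_j=q^{-1}u_ju_i$ for $0<j-i<k$. **Noncommutative Schur functions.** For $S\subseteq\mathbb{Z}$ and $d\geq 1$, $e_d(S)=\sum u_{i_1}u_{i_2}\cdots u_{i_d}$ over all $i_1>i_2>\cdots>i_d$ in $S$; $e_0(S)=1$ and $e_d(S)=0$ for $d<0$. For a weak composition $\alpha=(\alpha_1,\dots,\alpha_l)$ and $S_1,\dots,S_l\subseteq\mathbb{Z}$, $$J_\alpha(S_1,\dots,S_l)=\sum_{\pi\in\mathcal{S}_l}\mathrm{sgn}(\pi)\,e_{\alpha_1+\pi(1)-1}(S_1)\,e_{\alpha_2+\pi(2)-2}(S_2)\cdots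 e_{\alpha_l+\pi(l)-l}(S_l).$$ For a partition $\lambda$ with $l=\lambda_1$ columns and conjugate partition $\lambda'$, $\mathfrak{J}_\lambda(\mathbf{u})=J_{\lambda'}(\mathbb{Z},\dots,\mathbb{Z})$ ($l$ arguments). This is a formal infinite sum of words. The relations are homogeneous with respect to the multiset of letters, so equalities of such infinite sums in $\mathcal{U}/I_k^{\mathrm{Lam}}$ mean: for every finite multiset $M$ of integers, the (finite) parts of the two sides consisting of words with multiset of letters $M$ are equal in $\mathcal{U}/I_k^{\mathrm{Lam}}$. **Tableaux.** Cells $(r,c)$: row $r$ numbered from north to south, column $c$ from west to east; the diagonal (content) of $(r,c)$ is $c-r$. The shape of $\lambda$ is $\{(r,c): 1\le c\le\lambda_r\}$. $\mathrm{RSST}_\lambda$ is the set of fillings $T$ of the shape of $\lambda$ with integers that strictly increase from west to east in rows, strictly increase from north to south in columns, and satisfy $T_{r,c}+3\le T_{r',c'}$ whenever $r<r'$ and $c<c'$. **Arrows.** For each pair of cells $(r,c),(r+1,c+1)$ of $T$ with $T_{r+1,c+1}=T_{r,c}+3$ there is one arrow: if $T_{r+1,c}=T_{r,c}+2$, a $\nwarrow$ arrow with tail $(r+1,c+1)$ and head $(r,c)$; if $T_{r+1,c}=T_{r,c}+1$, a $\searrow$ arrow with tail $(r,c)$ and head $(r+1,c+1)$. (One of these holds since entries strictly increase.) **The word $\mathrm{sqread}(T)$.** Let $D^1,\dots,D^t$ be the diagonals of $T$ from southwest to northeast. Let $\mathsf{w}^i$ be the word obtained by reading, in the $\nwarrow$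 direction, the entries of $D^i$ that are tails of $\nwarrow$ arrows, followed by the remaining entries of $D^i$ read in the $\searrow$ direction. Then $\mathrm{sqread}(T)=\mathsf{w}^1\mathsf{w}^2\cdots\mathsf{w}^t$. *)

(* Defs.v *)
From HB Require Import structures.
From mathcomp Require Import all_boot all_fingroup all_order all_algebra.
From mathcomp Require Import finmap.
From mathcomp Require Import boolp classical_sets functions cardinality fsbigop.
From mathcomp Require Import monalg zify.

Set Implicit Arguments.
Unset Strict Implicit.
Unset Printing Implicit Defensive.

Import Order.TTheory GRing.Theory Num.Theory.
Local Open Scope ring_scope.

Local Notation "x %:F" := (@FracField.tofrac _ x).

(* Q[qh, qh^-1], as the subring of Q(qh) of the fractions p / qh^n. *)

Definition is_laurent : {pred {fraction {poly rat}}} :=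
  fun x => `[< exists (n : nat) (p : {poly rat}), x * ('X^n)%:F = p%:F >].

Lemma is_laurentP x :
  reflect (exists (n : nat) (p : {poly rat}), x * ('X^n)%:F = p%:F)
          (x \in is_laurent).
Proof. exact: asboolP. Qed.

Lemma is_laurent_subring : subring_closed is_laurent.
Proof.
split.
- by apply/is_laurentP; exists 0%N, 1; rewrite expr0 mul1r.
- move=> x y /is_laurentP[n [p xE]] /is_laurentP[m [r yE]].
  apply/is_laurentP; exists (n + m)%N, (p * 'X^m - r * 'X^n).
  rewrite exprD tofracM tofracB !tofracM -xE -yE mulrBl mulrA; congr (_ - _).
  by rewrite -!mulrA; congr (_ * _); rewrite mulrC.
- move=> x y /is_laurentP[n [p xE]] /is_laurentP[m [r yE]].
  apply/is_laurentP; exists (n + m)%N, (p * r).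
  by rewrite exprD !tofracM -xE -yE mulrACA.
Qed.

HB.instance Definition _ :=
  GRing.isSubringClosed.Build {fraction {poly rat}} is_laurent
    is_laurent_subring.

Record laurent := Laurent {
  laurent_val :> {fraction {poly rat}};
  laurent_valP : laurent_val \in is_laurent }.

HB.instance Definition _ := [isSub for laurent_val].
HB.instance Definition _ := [Choice of laurent by <:].
HB.instance Definition _ := [SubChoice_isSubComNzRing of laurent by <:].

Lemma qhat_subproof : ('X : {poly rat})%:F \in is_laurent.
Proof. by apply/is_laurentP; exists 0%N, 'X; rewrite expr0 mulr1. Qed.

Lemma qhatV_subproof : (('X : {poly rat})%:F)^-1 \in is_laurent.
Proof.
apply/is_laurentP; exists 1%N, 1; rewrite expr1 mulVf //.
by rewrite tofrac_eq0 polyX_eq0.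
Qed.

Definition qhat : laurent := Laurent qhat_subproof.
Definition qhatV : laurent := Laurent qhatV_subproof.

Definition q : laurent := qhatV ^+ 2.
Definition qV : laurent := qhat ^+ 2.

Lemma qhatVK : qhat * qhatV = 1.
Proof.
apply: val_inj; rewrite rmorphM rmorph1 /= mulfV //.
by rewrite tofrac_eq0 polyX_eq0.
Qed.

Lemma qVK : q * qV = 1.
Proof. by rewrite -exprMn mulrC qhatVK expr1n. Qed.

Notation freealg := {malg laurent[{fmonom int}]}.

Definition u (i : int) : freealg := << fmu i >>.
Definition mon (w : seq int) : freealg := \prod_(i <- w) u i.

Inductive two_sided_ideal (R : nzRingType) (G : R -> Prop) : R -> Prop :=
| ideal_gen a of G a : two_sided_ideal G a
| ideal_0 : two_sided_ideal G 0
| ideal_D a b of two_sided_ideal G a & two_sided_ideal G b :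
    two_sided_ideal G (a + b)
| ideal_M x a y of two_sided_ideal G a : two_sided_ideal G (x * a * y).

Inductive lam_rel (k : nat) : freealg -> Prop :=
| lam_sqr i : lam_rel k (u i * u i)
| lam_braidl i : lam_rel k (u (i + k%:Z) * u i * u (i + k%:Z))
| lam_braidr i : lam_rel k (u i * u (i + k%:Z) * u i)
| lam_far i j of k%:Z < `|i - j| : lam_rel k (u i * u j - u j * u i)
| lam_near i j of 0 < j - i & j - i < k%:Z :
    lam_rel k (u i * u j - qV *: (u j * u i)).

Definition lam_eq (k : nat) (a b : freealg) : Prop :=
  two_sided_ideal (lam_rel k) (a - b).

(* Formal, possibly infinite, linear combinations of words, given by the
   coefficient of each word. *)
Definition series := seq int -> laurent.

Definition ser_mon (v : seq int) : series := fun w => (w == v)%:R.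

(* Every word has finitely many factorizations as a concatenation. *)
Definition ser_mul (f g : series) : series :=
  fun w => \sum_(i < (size w).+1) f (take i w) * g (drop i w).

Definition ser_part (s : seq int) (f : series) : freealg :=
  \sum_(w <- permutations s) f w *: mon w.

Definition ser_lam_eq (k : nat) (f g : series) : Prop :=
  forall s : seq int, lam_eq k (ser_part s f) (ser_part s g).

Definition e (d : int) (S : pred int) : series :=
  fun w => [&& (size w)%:Z == d, sorted (fun i j : int => j < i) w
             & all S w]%:R.

(* The index shift between 'I_l and {1, ..., l} cancels in pi(j) - j.  The
   product is taken in increasing order of j. *)
Definition J (l : nat) (alpha : 'I_l -> nat) (S : 'I_l -> pred int) : series :=
  fun w => \sum_(pi : 'S_l) (-1) ^+ pi *
    (\big[ser_mul/ser_mon [::]]_(j < l)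
       e ((alpha j)%:Z + (pi j)%:Z - j%:Z) (S j)) w.

Definition is_partition (lam : seq nat) : bool :=
  sorted geq lam && (0%N \notin lam).

Definition conj_part (lam : seq nat) (c : nat) : nat :=
  count (fun r => c < r)%N lam.

Definition frakJ (lam : seq nat) : series :=
  @J (head 0%N lam) (fun j => conj_part lam j) (fun _ => predT).

(* Fillings are given by the list of their rows; rows and columns are numbered
   from 0, which does not affect contents. *)
Definition in_shape (lam : seq nat) (r c : nat) : bool := (c < nth 0 lam r)%N.

Definition entry (T : seq (seq int)) (r c : nat) : int := nth 0 (nth [::] T r) c.

Definition RSST (lam : seq nat) : set (seq (seq int)) :=
  [set T | [/\ shape T = lam,
    forall r c c', in_shape lam r c -> in_shape lam r c' ->
      (c < c')%N -> entry T r c < entry T r c',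
    forall r r' c, in_shape lam r c -> in_shape lam r' c ->
      (r < r')%N -> entry T r c < entry T r' c
  & forall r r' c c', in_shape lam r c -> in_shape lam r' c' ->
      (r < r')%N -> (c < c')%N -> entry T r c + 3 <= entry T r' c']]%classic.

(* For cells (r, c) and (r + 1, c + 1) of T: there is a north-west arrow with
   tail (r + 1, c + 1) and head (r, c). *)
Definition nw_arrow (T : seq (seq int)) (r c : nat) : bool :=
  (entry T r.+1 c.+1 == entry T r c + 3) && (entry T r.+1 c == entry T r c + 2).

Definition nw_tail (T : seq (seq int)) (x : nat * nat) : bool :=
  [&& (0 < x.1)%N, (0 < x.2)%N & nw_arrow T x.1.-1 x.2.-1].

Definition cells (lam : seq nat) : seq (nat * nat) :=
  [seq (r, c) | r <- iota 0 (size lam), c <- iota 0 (nth 0%N lam r)].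

(* The cells of content d, from north-west to south-east. *)
Definition diagonal (lam : seq nat) (d : int) : seq (nat * nat) :=
  [seq x <- cells lam | x.2%:Z - x.1%:Z == d].

Definition diag_word (T : seq (seq int)) (d : int) : seq int :=
  let D := diagonal (shape T) d in
  [seq entry T x.1 x.2 |
     x <- rev [seq x <- D | nw_tail T x] ++ [seq x <- D | ~~ nw_tail T x]].

(* The contents of a nonempty shape range from 1 - size lam to head 0 lam - 1. *)
Definition contents (lam : seq nat) : seq int :=
  [seq i%:Z - (size lam)%:Z | i <- iota 1 (size lam + head 0%N lam).-1].

Definition sqread (T : seq (seq int)) : seq int :=
  flatten [seq diag_word T d | d <- contents (shape T)].

Lemma mem_sqread (T : seq (seq int)) x :
  is_partition (shape T) -> x \in flatten T -> x \in sqread T.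
Proof.
move=> /andP[Tsort T0] /flattenP[row /(nthP [::])[r rT <-] /(nthP 0)[c cT <-]].
have szr : nth 0%N (shape T) r = size (nth [::] T r) by rewrite (nth_map [::]).
have hd : (nth 0%N (shape T) r <= head 0%N (shape T))%N.
  rewrite -nth0; apply: (sorted_leq_nth (leT := geq)) => //.
  - by move=> n m p /= mn pm; apply: leq_trans pm mn.
  - by move=> n /=.
  - by rewrite inE size_map (leq_ltn_trans (leq0n r)).
  - by rewrite inE size_map.
apply/flattenP; exists (diag_word T (c%:Z - r%:Z)).
  apply: map_f; apply/mapP; exists (c + size T - r)%N.
    rewrite mem_iota size_map.
    have := leq_trans cT (leq_trans (eq_leq (esym szr)) hd).
    by move: rT; move: (size T) (head _ _) => a b; lia.
  by rewrite size_map; move: rT; move: (size T) => a; lia.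
apply/mapP; exists (r, c) => //.
rewrite mem_cat mem_rev !mem_filter /= eqxx /= -andb_orl orbN /=.
apply/allpairsPdep; exists r, c; split=> //.
  by rewrite mem_iota size_map.
by rewrite mem_iota szr.
Qed.

Lemma sqread_fiber_finite (lam : seq nat) (w : seq int) :
  is_partition lam ->
  finite_set [set T | RSST lam T /\ sqread T = w]%classic.
Proof.
move=> lamP; set n := sumn lam.
pose f (t : n.-tuple 'I_(size w)) :=
  reshape lam [seq nth 0 w (nat_of_ord i) | i <- t].
apply: (sub_finite_set (B := [set f t | t in setT]%classic)); last first.
  exact: finite_image (@finite_finset _ _).
move=> T [[shT _ _ _] wE]; rewrite -shT in lamP.
have flw x : x \in flatten T -> x \in w by rewrite -wE; exact: mem_sqread.
have [s ss sE] : exists2 s : seq 'I_(size w), size s = n &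
    flatten T = [seq nth 0 w (nat_of_ord i) | i <- s].
  have -> : n = size (flatten T) by rewrite size_flatten shT.
  elim: (flatten T) flw => [|x l IH] lw; first by exists [::].
  have [|s ss ->] := IH; first by move=> y yl; apply: lw; rewrite inE yl orbT.
  have xw : (index x w < size w)%N by rewrite index_mem lw ?mem_head.
  by exists (Ordinal xw :: s); rewrite /= ?size_map ?ss ?nth_index ?lw ?mem_head.
have ss' : size s == n by rewrite ss.
by exists (Tuple ss') => //; rewrite /f /= -sE -shT flattenK.
Qed.

(* Only finitely many terms contribute to each coefficient: see
   sqread_fiber_finite. *)
Definition RSST_sum (lam : seq nat) : series :=
  fun w => \sum_(T \in RSST lam) ser_mon (sqread T) w.

(* Main.v *)
(* Adjoin to R = U/I anticommuting square-zero variables v_0, ..., v_(l-1) and set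
   C(n, s) = sum_i e_(i+s)([lo, n]) v_i.  The ordered product of the
   C(hi, lam'_c - c) over the columns c is J_lam times v_0 ... v_(l-1), so J_lam can
   be computed in this ring, from
     C(n, s) = C(n-1, s) + u_n C(n-1, s-1)   and   C(n, s)^2 = 0,
   the latter because the e_d([lo, n]) commute.  If P u_y = 0, these relations give
     P C(y-1, s) C(n, s) =
       sum_(y+2 <= x <= n) P C(y-1, s) u_x C(x-1, s-1)
       + P u_(y+1) C(y-2, s) C(y, s-1),
   where u_x, the new entry of the right column, lies on the diagonal next to the one
   of y, its west neighbour.  Iterating over the columns reads off a whole diagonal, in
   the order prescribed by its arrows, and iterating over the diagonals from southwest
   to northeast reads off all of sqread(T). *)

(* A whole diagonal can be read in one go because all columns that meet the diagonal of content -s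
   share the index s: above its cell, column c still has c + s cells, which is the degree of the e
   that accompanies v_c in C(n, s). The hypothesis P u_y = 0, which makes C(y-1, s) and C(y, s)
   interchangeable after P, comes from the word already read: u_x^2 = 0 and both braid relations
   make it vanish when multiplied on the right by any entry of the last diagonal. The obstacle is
   the first row. A column d that ends there has s = -d, but C(n, -d) is v_d plus terms in v_(d+1),
   ..., v_(l-1), which disappear only in front of enough further columns. Hence the degree in these
   variables of everything to the right has to be tracked. The infinite sums are made finite by
   fixing a multiset of letters and an interval [lo, hi] that contains it; returning to the multiset
   at the end is legitimate because the relations are homogeneous. *)
From HB Require Import structures.
Require Import Defs.
From mathcomp Require Import all_boot all_fingroup all_order all_algebra.
From mathcomp Require Import finmap boolp classical_sets fsbigop.
From mathcomp Require Import generic_quotient ring_quotient monalg zify.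

Set Implicit Arguments.
Unset Strict Implicit.
Unset Printing Implicit Defensive.

Import Order.TTheory GRing.Theory Num.Theory.
Local Open Scope ring_scope.

(** * Commutation of the elementary functions *)

(* Used with Z_t = 1 + t z, A_t = 1 + t a, w = t s and k = [a, z]: the product of the
   factors 1 + t u_x over z > ... > a commutes with its analogue in s as soon as the
   products with either end removed do. *)
Lemma comm_two_ends (B : pzRingType) (w k Mt Ms Nt Ns Zt Zs At As : B) :
  Mt * Nt = 1 -> Nt * Mt = 1 -> Ms * Ns = 1 -> Ns * Ms = 1 ->
  GRing.comm w Zt -> GRing.comm w Zs -> GRing.comm w Mt -> GRing.comm w Ms ->
  GRing.comm k Mt -> GRing.comm k Ms -> GRing.comm Mt Ms ->
  At * Zs = Zs * At + w * k -> As * Zt = Zt * As + w * k ->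
  Zt * k = k -> Zs * k = k -> k * At = k -> k * As = k ->
  GRing.comm (Zt * Mt) (Zs * Ms) -> GRing.comm (Mt * At) (Ms * As) ->
  GRing.comm (Zt * Mt * At) (Zs * Ms * As).
Proof.
move=> MNt NMt MNs NMs wZt wZs wMt wMs kMt kMs MM eAZ eAZ' Zk Zk' kA kA' cZ cA.
have eqZ : Zt * Mt * Zs = Zs * Ms * Zt * Mt * Ns.
  by rewrite -(mulrA (Zs * Ms)) -cZ -!mulrA MNs !mulr1.
have eqA : At * Ms * As = Nt * Ms * As * Mt * At.
  have := congr1 (fun x => Nt * x) cA.
  by rewrite !mulrA NMt mul1r.
have MNNM : Mt * Ns * Nt * Ms = 1.
  have MN : Mt * Ns = Ns * Mt.
    by rewrite -[LHS]mul1r -NMs -mulrA (mulrA Ms) -MM -!mulrA MNs mulr1.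
  by rewrite MN -(mulrA Ns) MNt mulr1 NMs.
rewrite /GRing.comm.
transitivity (Zt * Mt * (At * Zs) * (Ms * As)); first by rewrite !mulrA.
transitivity (Zs * Ms * (As * Zt) * (Mt * At)); last by rewrite !mulrA.
rewrite eAZ eAZ' !mulrDr !mulrDl; congr (_ + _).
- rewrite !mulrA eqZ -!mulrA; congr (_ * (_ * (_ * _))).
  by rewrite (mulrA At) eqA !mulrA MNNM mul1r.
- have Hw (Z M M' A : B) : GRing.comm w Z -> GRing.comm w M -> GRing.comm k M -> GRing.comm k M' ->
     Z * k = k -> k * A = k -> Z * M * (w * k) * (M' * A) = w * k * (M * M').
    move=> c1 c2 c3 c4 Zk1 kA1; transitivity (w * (Z * (M * k) * M' * A)).
      by rewrite !mulrA c1 -(mulrA Z w) c2 !mulrA.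
    have kMM : k * (M * M') = M * M' * k by exact: commrM.
    rewrite -c3 (mulrA Z) Zk1 -(mulrA k) kMM -(mulrA w) -(mulrA _ k) kA1.
    by rewrite -kMM mulrA.
  by rewrite !Hw // MM.
Qed.

Section GProd.
Variables (B : pzRingType) (U : int -> B) (t s : B).
Hypotheses (uu : forall x, U x * U x = 0).
Hypotheses (zaz : forall a z, a < z -> U z * U a * U z = 0).
Hypotheses (aza : forall a z, a < z -> U a * U z * U a = 0).
Hypotheses (mid : forall a b z, a < b -> b < z ->
  GRing.comm (U a * U z - U z * U a) (U b)).
Hypotheses (tC : forall y, GRing.comm t y) (sC : forall y, GRing.comm s y).

Definition gprod (b : B) (L : seq int) : B := \prod_(x <- L) (1 + b * U x).

(** Induction on the length, with the extreme letters [z] and [a] split off: the products lacking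
    one end commute by induction, and the bracket of the two ends commutes with every letter in
    between, so [comm_two_ends] applies. *)
Lemma gprod_comm (L : seq int) : pairwise (fun i j : int => j < i) L ->
  GRing.comm (gprod t L) (gprod s L).
Proof.
have cen2 (b c x y : B) : (forall y, GRing.comm b y) -> (forall y, GRing.comm c y) ->
    (b * x) * (c * y) = (b * c) * (x * y).
  by move=> bC cC; rewrite -!mulrA (mulrA x) -(cC x) !mulrA.
have inv (b : B) M : (forall y, GRing.comm b y) ->
    exists N, gprod b M * N = 1 /\ N * gprod b M = 1.
  move=> bC; elim: M => [|x M [N [N1 N2]]]; first by exists 1; rewrite /gprod big_nil mulr1.
  exists (N * (1 - b * U x)); rewrite /gprod big_cons -/(gprod _ _).
  have bxx : b * U x * (b * U x) = 0 by rewrite cen2 // uu mulr0.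
  have E : (1 + b * U x) * (1 - b * U x) = 1.
    by rewrite mulrDl mul1r mulrBr mulr1 bxx subr0 subrK.
  have E' : (1 - b * U x) * (1 + b * U x) = 1.
    by rewrite mulrBl mul1r mulrDr mulr1 bxx addr0 addrK.
  split; first by rewrite -mulrA (mulrA _ N) N1 mul1r.
  by rewrite -mulrA (mulrA _ _ (gprod b M)) E' mul1r.
have [n] := ubnP (size L); elim: n L => // n IH [|z L] szL srt.
  by rewrite /gprod !big_nil.
case/lastP: L szL srt => [|M a] szL srt.
  rewrite /gprod !big_seq1 /GRing.comm !mulrDl !mul1r !mulrDr !mulr1.
  by rewrite (cen2 t s) // (cen2 s t) // uu !mulr0 !addr0 addrAC.
have szM : ((size M).+2 <= n)%N by move: szL; rewrite /= size_rcons.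
move: (srt); rewrite /= pairwise_rcons all_rcons => /andP[/andP[az zM] /andP[aM srtM]].
have cM := IH M (ltnW szM) srtM.
have c1 : GRing.comm (gprod t (z :: M)) (gprod s (z :: M)).
  by apply: IH; rewrite //= zM srtM.
have c2 : GRing.comm (gprod t (rcons M a)) (gprod s (rcons M a)).
  by apply: IH; rewrite ?size_rcons // pairwise_rcons aM.
have [Nt [Nt1 Nt2]] := inv t M tC.
have [Ns [Ns1 Ns2]] := inv s M sC.
have kM (b : B) : (forall y, GRing.comm b y) -> GRing.comm (U a * U z - U z * U a) (gprod b M).
  move=> bC; rewrite /gprod big_seq; apply: commr_prod => x xM.
  apply: commrD; first exact: commr1.
  apply: commrM; first exact/commr_sym/bC.
  by apply: mid; [exact: (allP aM) | exact: (allP zM)].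
have gE (b : B) : gprod b (z :: rcons M a) = (1 + b * U z) * gprod b M * (1 + b * U a).
  by rewrite /gprod big_cons -cats1 big_cat big_seq1 mulrA.
move: c1 c2; rewrite !gE /gprod !big_cons -!cats1 !big_cat !big_seq1 -!/(gprod _ _) => c1 c2.
have stC y : GRing.comm (t * s) y by apply/commr_sym/commrM; apply/commr_sym.
have ax b c : (forall y, GRing.comm b y) -> (forall y, GRing.comm c y) -> b * c = t * s ->
    (1 + b * U a) * (1 + c * U z) = (1 + c * U z) * (1 + b * U a) + t * s * (U a * U z - U z * U a).
  move=> bC cC bc; rewrite !mulrDl !mul1r !mulrDr !mulr1 (cen2 b c) // (cen2 c b) // (cC b) bc mulrN.
  rewrite [t * s * _ - _]addrC -!addrA addNKr; congr (_ + _); exact: addrCA.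
have kz b : (forall y, GRing.comm b y) -> (1 + b * U z) * (U a * U z - U z * U a) = U a * U z - U z * U a.
  by move=> bC; rewrite mulrDl mul1r -mulrA mulrBr !mulrA zaz // uu mul0r subr0 mulr0 addr0.
have ka b : (forall y, GRing.comm b y) -> (U a * U z - U z * U a) * (1 + b * U a) = U a * U z - U z * U a.
  by move=> bC; rewrite mulrDr mulr1 mulrA -bC -mulrA mulrBl aza // -!mulrA uu mulr0 subr0 mulr0 addr0.
apply: (@comm_two_ends _ (t * s) (U a * U z - U z * U a) _ _ Nt Ns) => //;
  try exact: kM; try exact: kz; try exact: ka.
all: by apply: ax => //; exact/esym/tC.
Qed.
End GProd.

Section ESym.
Variables (R : nzRingType) (u : int -> R).

Fixpoint esym (L : seq int) (d : int) : R :=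
  if L is x :: L' then esym L' d + u x * esym L' (d - 1) else (d == 0)%:R.

Lemma esym_lt0 L d : d < 0 -> esym L d = 0.
Proof.
elim: L d => [|x L IH] d d0 /=; first by case: eqP d0 => // ->.
by rewrite !IH ?mulr0 ?addr0 //; lia.
Qed.

Lemma coef_gprod L n : (gprod (fun x => (u x)%:P) 'X L)`_n = esym L n%:Z.
Proof.
elim: L n => [|x L IH] n; rewrite /gprod ?big_nil ?coef1 ?big_cons -?/(gprod _ _ _) //=.
rewrite mulrDl mul1r coefD IH -mulrA coefXM coefCM; congr (_ + _).
case: n => [|n] /=; first by rewrite esym_lt0 ?mulr0.
by rewrite IH; congr (_ * esym L _); lia.
Qed.

Hypotheses (uu : forall x, u x * u x = 0).
Hypotheses (zaz : forall a z, a < z -> u z * u a * u z = 0).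
Hypotheses (aza : forall a z, a < z -> u a * u z * u a = 0).
Hypotheses (mid : forall a b z, a < b -> b < z ->
  GRing.comm (u a * u z - u z * u a) (u b)).

(** Coefficient of t^a s^b in the commutation of the generating functions; the two central variables
    are ['X] and ['X%:P] in the nested polynomial ring. *)
Lemma esym_comm L d d' : pairwise (fun i j : int => j < i) L ->
  GRing.comm (esym L d) (esym L d').
Proof.
move=> srt.
case: d => [a|a]; last by rewrite (@esym_lt0 _ (Negz a)) //; exact/commr_sym/commr0.
case: d' => [b|b]; last by rewrite (@esym_lt0 _ (Negz b)) //; exact/commr0.
pose U x : {poly {poly R}} := (u x)%:P%:P; pose G := gprod (fun x => (u x)%:P) 'X L.
have gT : gprod U 'X L = map_poly polyC G.
  rewrite /gprod rmorph_prod; apply: eq_bigr => x _.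
  by rewrite rmorphD rmorph1 rmorphM /= map_polyX map_polyC.
have gS : gprod U 'X%:P L = G%:P.
  rewrite /gprod rmorph_prod; apply: eq_bigr => x _.
  by rewrite rmorphD rmorph1 rmorphM.
have : GRing.comm (gprod U 'X L) (gprod U 'X%:P L).
  apply: gprod_comm => //; rewrite /U.
  - by move=> x; rewrite -!rmorphM uu !rmorph0.
  - by move=> x z xz; rewrite -!rmorphM zaz ?rmorph0.
  - by move=> x z xz; rewrite -!rmorphM aza ?rmorph0.
  - move=> x y z xy yz; rewrite /GRing.comm -!rmorphM -!rmorphB -!rmorphM.
    by rewrite mid.
  - by move=> y; exact/commr_sym/commr_polyX.
  - move=> y; apply/polyP => i; rewrite coefCM coefMC.
    exact/commr_sym/commr_polyX.
rewrite gT gS => /(congr1 (fun p : {poly {poly R}} => p`_a`_b)).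
rewrite coefMC coefCM coef_map /= coefCM coefMC.
by rewrite /G !coef_gprod.
Qed.

End ESym.

(** * Determinants in an exterior algebra *)

(* One variable at a time, by 2 x 2 matrices: the new variable is [[0, 0], [1, 0]] and
   the old ones become diag(v, -v). *)
Lemma exterior_algebra_exists (R : nzRingType) (l : nat) :
  exists (X : nzRingType) (io : {rmorphism R -> X}) (v : nat -> X) (phi : X -> R),
  [/\ forall r i, GRing.comm (io r) (v i), forall i, v i * v i = 0,
      forall i j, v i * v j = - (v j * v i)
    & forall r, phi (io r * \prod_(i < l) v i) = r].
Proof.
elim: l => [|l [X [io [v [phi [cV sV aV pV]]]]]].
  exists R, idfun, (fun=> 0), id; split=> [r i|i|i j|r]; rewrite ?mulr0 ?oppr0 //.
    exact: commr0.
  by rewrite big_ord0 mulr1.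
pose sg (b : 'I_2) (x : X) := if b == 0 then x else - x.
pose w i : 'M[X]_2 := diag_mx (\row_b sg b (v i)).
pose v' i : 'M[X]_2 := if i is j.+1 then w j else delta_mx 1 0.
have sgM (b : 'I_2) x y : sg b x * sg b y = x * y by rewrite /sg; case: ifP; rewrite ?mulrNN.
have ww i j : w i * w j = diag_mx (\row_b (v i * v j)).
  by rewrite -[_ * _]/(_ *m _) mulmx_diag; congr diag_mx; apply/rowP => b; rewrite !mxE sgM.
have dw i : delta_mx 1 0 * w i = - (w i * delta_mx 1 0).
  apply/matrixP => a b; rewrite -[_ * _]/(_ *m _) -[w i * _]/(_ *m _) /w.
  rewrite mul_mx_diag mxE mul_diag_mx !mxE /sg.
  have : b = 0 \/ b = 1 by case: b => [[|[|//]]] ?; [left|right]; apply: val_inj.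
  have : a = 0 \/ a = 1 by case: a => [[|[|//]]] ?; [left|right]; apply: val_inj.
  by case=> ->; case=> ->; rewrite /= ?(mulr0,mul0r,mul1r,mulr1,oppr0,opprK).
exists ('M[X]_2 : nzRingType), (scalar_mx \o io)%FUN, v', (fun M : 'M[X]_2 => phi (M 1 0)); split.
- move=> r i /=; rewrite /GRing.comm /= -[LHS]/(_ *m _) -[RHS]/(_ *m _) mul_scalar_mx.
  rewrite -diag_const_mx; apply/matrixP => a b; rewrite mul_mx_diag !mxE.
  case: i => [|i] /=; rewrite !mxE.
    by case: (_ && _); rewrite ?(mulr0,mul0r,mul1r,mulr1).
  rewrite /sg; case: (a == b); rewrite ?mulr1n ?mulr0n ?mulr0 ?mul0r //.
  by case: (_ == 0); rewrite ?mulrN ?mulNr cV.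
- case=> [|i] /=; last by rewrite ww sV; apply/matrixP => a b; rewrite !mxE mul0rn.
  by rewrite -[LHS]/(_ *m _) mul_delta_mx_0.
- case=> [|i] [|j] //=.
  + by rewrite -[LHS]/(_ *m _) -[X in - X]/(_ *m _) mul_delta_mx_0 // oppr0.
  + by rewrite dw opprK.
  + by rewrite !ww aV; apply/matrixP => a b; rewrite !mxE mulNrn.
- move=> r; rewrite big_ord_recl /=.
  (* The new variable comes first in the product and carries row 0 of diag(v, -v) to row 1, so the
     entry (1, 0) read by [phi] has no sign. *)
  have D00 : (\prod_(i < l) w i) 0 0 = \prod_(i < l) v i.
    elim/big_rec2: _ => [|i p M _ M0]; first by rewrite mxE.
    by rewrite -[_ * _]/(_ *m _) mul_diag_mx !mxE M0.
  rewrite -[_ * _]/(_ *m (_ *m _)) mul_scalar_mx 2!mxE big_ord_recl big_ord1 !mxE /=.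
  by rewrite mul1r mul0r addr0 D00 pV.
Qed.

Section Anticommuting.
Variable X : nzRingType.

Lemma prod_anticomm_lift n (w : 'I_n.+1 -> X) (j : 'I_n.+1) :
  (forall a b, w a * w b = - (w b * w a)) ->
  \prod_k w k = (-1) ^+ j * (w j * \prod_k w (lift j k)).
Proof.
elim: n w j => [|n IH] w j wa; first by rewrite (ord1 j) expr0 mul1r big_ord_recl.
have [[j' ->]|->] : (exists j' : 'I_n.+1, j = lift ord0 j') \/ j = ord0.
- by case: (unliftP ord0 j) => [j'|] ->; [left; exists j' | right].
- rewrite big_ord_recl (IH (fun k => w (lift (ord0 : 'I_n.+2) k)) j') // [in RHS]big_ord_recl.
  rewrite [lift (lift ord0 j') ord0](_ : _ = ord0); last exact: val_inj.
  rewrite lift0 exprS mulN1r mulNr [LHS]mulrA commr_sign -[LHS]mulrA -mulrN; congr (_ * _).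
  rewrite mulrA [w ord0 * _]wa mulNr -mulrA; congr (- (_ * (_ * _))); apply: eq_bigr => k _.
  by congr w; apply: val_inj; rewrite /= /bump /=; lia.
- by rewrite expr0 mul1r big_ord_recl.
Qed.

Lemma prod_anticomm_eq0 n (w : 'I_n -> X) (i j : 'I_n) :
  (forall a b, w a * w b = - (w b * w a)) -> (forall a, w a * w a = 0) ->
  i != j -> w i = w j -> \prod_k w k = 0.
Proof.
case: n w i j => [|n] w i j wa ww ij wij; first by case: i ij wij.
rewrite (prod_anticomm_lift i) //.
have [k /= jk _] := unlift_some ij.
case: n w i j wa ww ij wij k jk => [|n] w i j wa ww ij wij k jk; first by case: k jk.
rewrite (prod_anticomm_lift k) // (mulrA (w i)) commr_sign -jk -wij -mulrA (mulrA (w i)) ww.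
by rewrite mul0r !mulr0.
Qed.

Lemma prod_anticomm_perm n (w : 'I_n -> X) (s : 'S_n) :
  (forall a b, w a * w b = - (w b * w a)) ->
  \prod_k w (s k) = (-1) ^+ s * \prod_k w k.
Proof.
elim: n w s => [|n IH] w s wa.
  by rewrite !big_ord0 (_ : s = 1%g) ?odd_perm1 ?expr0 ?mul1r //; apply/permP => [[]].
have ulsf k : {k' | s (lift ord0 k) = lift (s ord0) k'}.
  have : s ord0 != s (lift ord0 k) by rewrite (can_eq (permK s)) neq_lift.
  by case/unlift_some => k' e _; exists k'.
have inj : injective (fun k => sval (ulsf k)).
  move=> a b /= e; apply: (@lift_inj _ ord0); apply: (@perm_inj _ s).
  by rewrite (svalP (ulsf a)) (svalP (ulsf b)) e.
have -> : s = lift_perm ord0 (s ord0) (perm inj).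
  apply/permP => k; case: (unliftP ord0 k) => [k'|] ->; rewrite ?lift_perm_id //.
  by rewrite lift_perm_lift permE -(svalP (ulsf k')).
move: (s ord0) (perm inj) => j t {ulsf inj}.
rewrite odd_lift_perm signr_addb /= -mulrA signr_odd big_ord_recl lift_perm_id.
have -> : \prod_(i < n) w (lift_perm ord0 j t (lift ord0 i)) = \prod_(i < n) w (lift j (t i)).
  by apply: eq_bigr => k _; rewrite lift_perm_lift.
rewrite (IH (fun k => w (lift j k))) // (prod_anticomm_lift j) //.
rewrite [in RHS](mulrA ((-1) ^+ t)) (commr_sign ((-1) ^+ t)) -(mulrA _ _ (w j * _)).
by rewrite [RHS]mulrA -expr2 sqrr_sign mul1r !mulrA commr_sign.
Qed.

Lemma prod_wedge (R : nzRingType) (io : {rmorphism R -> X}) n (r : 'I_n -> R) (w : 'I_n -> X) :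
  (forall x j, GRing.comm (io x) (w j)) ->
  \prod_j (io (r j) * w j) = io (\prod_j r j) * \prod_j w j.
Proof.
elim: n r w => [|n IH] r w cw; first by rewrite !big_ord0 rmorph1 mul1r.
rewrite !big_ord_recl IH // rmorphM -!mulrA; congr (_ * _).
by rewrite !mulrA; congr (_ * _); rewrite cw.
Qed.

(** Expansion of a determinant with noncommuting entries: a choice that is not injective repeats a
    square-zero variable, a permutation contributes its sign, and the entries keep the order of the
    factors. *)
Lemma prod_sum_wedge (R : nzRingType) (io : {rmorphism R -> X}) (v : nat -> X) l (f : 'I_l -> 'I_l -> R) :
  (forall x j, GRing.comm (io x) (v j)) -> (forall a b, v a * v b = - (v b * v a)) ->
  (forall a, v a * v a = 0) ->
  \prod_(j < l) (\sum_(i < l) io (f j i) * v i) =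
  io (\sum_(s : 'S_l) (-1) ^+ s * \prod_(j < l) f j (s j)) * \prod_(i < l) v i.
Proof.
move=> cv va vv; rewrite bigA_distr_bigA /=.
rewrite (bigID (fun g : {ffun 'I_l -> 'I_l} => injectiveb g)) /= addrC big1 ?add0r; last first.
  move=> g /injectivePn[i [j ij gij]].
  by rewrite prod_wedge // (@prod_anticomm_eq0 _ _ i j) ?mulr0 // gij.
rewrite rmorph_sum mulr_suml (reindex (@pval _)) /=; last first.
  pose in_Sn := insubd (1%g : 'S_l).
  by exists in_Sn => /= f' Uf; first apply: val_inj; apply: insubdK.
apply: eq_big => [s|s _]; first by rewrite (valP s).
rewrite prod_wedge // rmorphM rmorph_sign /= pvalE.
by rewrite (@prod_anticomm_perm _ (fun i => v i) s) // !mulrA commr_sign.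
Qed.
End Anticommuting.

(** * Reading off one diagonal *)

Definition irange (a b : int) : seq int :=
  [seq a + i%:Z | i <- iota 0 (if a <= b then (absz (b - a)%R).+1 else 0%N)].

Lemma mem_irange a b x : (x \in irange a b) = (a <= x <= b).
Proof.
apply/mapP/idP => [[i]|ax].
  by case: (leP a b) => ab; rewrite mem_iota; lia.
have ab : a <= b by lia.
by exists (absz (x - a)%R); rewrite ?ab ?mem_iota; lia.
Qed.

Lemma irange_uniq a b : uniq (irange a b).
Proof. by rewrite map_inj_uniq ?iota_uniq // => i j; lia. Qed.

Lemma irange_recl a b : a <= b -> irange a b = a :: irange (a + 1) b.
Proof.
move=> ab; rewrite /irange ab /= addr0 (iotaDl 1 0) -map_comp; congr (_ :: _).
have -> : (if a + 1 <= b then (absz (b - (a + 1))%R).+1 else 0%N) = absz (b - a)%R.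
  by case: (leP (a + 1) b) => ?; lia.
by apply: eq_map => i /=; lia.
Qed.

Lemma irange_nil a b : b < a -> irange a b = [::].
Proof. by rewrite /irange ltNge => /negbTE ->. Qed.

Lemma irange_recr a b : a <= b -> irange a b = rcons (irange a (b - 1)) b.
Proof.
move=> ab; rewrite /irange ab -(addn1 (absz _)) iotaD map_cat /= cats1; congr rcons; last by lia.
by congr (map _ (iota _ _)); case: (leP a (b - 1)) => ?; lia.
Qed.

(* [dvals m0 ys n] lists the possible next diagonals: [ys] and its members are
   diagonals listed from south-east to north-west, [ys] consists of the west
   neighbours of all cells but the last, [n] bounds the first entry from above
   and [m0] the last one from below. *)
Fixpoint dvals (m0 : int) (ys : seq int) (n : int) : seq (seq int) :=
  if ys is y :: ys' then
    flatten [seq [seq x :: zs | zs <- dvals m0 ys' (Order.min (y - 1) (x - 3))]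
            | x <- irange (y + 1) n]
  else [seq [:: x] | x <- irange m0 n].

(* The word read from the diagonal [zs]; [x] is the tail of a north-west arrow iff the
   condition of the [if] holds. *)
Fixpoint dword (ys zs : seq int) : seq int :=
  match ys, zs with
  | y :: ys', x :: zs' =>
    if (x == head 0 zs' + 3) && (y == head 0 zs' + 2) then x :: dword ys' zs'
    else rcons (dword ys' zs') x
  | _, _ => zs
  end.

(* Consecutive entries differ by at least 3 and the last one is at least [m]. *)
Fixpoint gapped (m : int) (ys : seq int) : bool :=
  if ys is y :: ys' then (if ys' is y' :: _ then y' + 3 <= y else m <= y) && gapped m ys' else true.

Lemma dvalsP m0 ys n zs : zs \in dvals m0 ys n ->
  [/\ size zs = (size ys).+1, head 0 zs <= n & all (<=%R^~ n) zs].
Proof.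
elim: ys n zs => [|y ys IH] n zs /=.
  by case/mapP => x; rewrite mem_irange => /andP[m0x xn] -> /=; rewrite xn.
case/flattenP => l /mapP[x]; rewrite mem_irange => /andP[yx xn] -> {l} /mapP[zs' /IH[sz hz az] ->].
split => //=; first by rewrite sz.
by rewrite xn /=; apply/allP => z /(allP az) /=; lia.
Qed.

Lemma dword_perm ys zs : perm_eq (dword ys zs) zs.
Proof.
elim: ys zs => [|y ys IH] [|x zs] //=; case: ifP => _; first by rewrite perm_cons.
by rewrite perm_rcons perm_cons.
Qed.

Section Diagonal.
Variables (X : nzRingType) (U : int -> X) (C : int -> int -> X).
Hypotheses (UU : forall x, U x * U x = 0).
Hypothesis (Ufar : forall x y, y + 3 < x -> GRing.comm (U x) (U y)).
Hypothesis (Ubraid : forall x, U (x + 3) * U x * U (x + 3) = 0).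
Hypothesis (Ubraid' : forall x, U x * U (x + 3) * U x = 0).
Hypothesis (Unear : forall x y P, x != y -> x - 3 < y -> y < x + 3 -> P * U x = 0 -> P * U y * U x = 0).
Hypothesis (Crec : forall n s, C n s = C (n - 1) s + U n * C (n - 1) (s - 1)).
Hypothesis (Csq : forall n s, C n s * C n s = 0).
Hypothesis (Canti : forall n s s', C n s * C n s' = - (C n s' * C n s)).
Hypothesis (Cfar : forall x n s, n + 3 < x -> GRing.comm (U x) (C n s)).
Hypothesis (Csand : forall x n s, n < x -> U x * C n s * U x = 0).

Lemma Cdrop P n s : P * U n = 0 -> P * C (n - 1) s = P * C n s.
Proof. by move=> Pn; rewrite [C n s]Crec mulrDr mulrA Pn mul0r addr0. Qed.

Lemma Ctele m n s : m <= n ->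
  C n s = C m s + \sum_(x <- irange (m + 1) n) U x * C (x - 1) (s - 1).
Proof.
move=> mn; have -> : n = m + (absz (n - m)%R)%:Z by lia.
elim: (absz _) => [|k IH]; first by rewrite irange_nil ?big_nil ?addr0 //; lia.
rewrite irange_recr; last by lia.
rewrite -cats1 big_cat big_seq1 /= addrA.
rewrite (_ : m + k.+1%:Z - 1 = m + k%:Z); last by lia.
by rewrite -IH [LHS]Crec (_ : m + k.+1%:Z - 1 = m + k%:Z); last by lia.
Qed.

(** This is the term x = y in the expansion of the right column; its vanishing makes rows strict.
    Here u_y C(y-1, s-1) = C(y, s) - C(y-1, s), and P C(y-1, s) can be matched with either term to
    form a square. *)
Lemma two_columns_eq P y s : P * U y = 0 -> P * C (y - 1) s * U y * C (y - 1) (s - 1) = 0.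
Proof.
move=> Py; have E : U y * C (y - 1) (s - 1) = C y s - C (y - 1) s by rewrite [C y s]Crec addrAC subrr add0r.
by rewrite -mulrA E mulrBr -(mulrA _ _ (C (y - 1) s)) Csq mulr0 subr0 Cdrop // -mulrA Csq mulr0.
Qed.

(* P C(y-1) u_(y+1) C(y) = P C(y) (C(y+1) - C(y)) = P C(y) C(y+1), where C(y) can be
   replaced by - u_(y+1) C(y) since C(y+1)^2 = 0; it remains to anticommute the two
   factors and to lower the index of the left one. *)
Lemma two_columns_succ P y s : P * U y = 0 ->
  P * C (y - 1) s * U (y + 1) * C y (s - 1) = P * U (y + 1) * C (y - 2) s * C y (s - 1).
Proof.
move=> Py; have E : U (y + 1) * C y (s - 1) = C (y + 1) s - C y s.
  by rewrite [C (y + 1) s]Crec addrK addrAC subrr add0r.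
have Q1 : P * U (y + 1) * U y = 0 by apply: Unear => //; lia.
have Q2 : P * U (y + 1) * U (y - 1) * U y = 0 by apply: Unear => //; lia.
have Q3 : P * U (y + 1) * U (y - 1) * U (y - 1) = 0 by rewrite -mulrA UU mulr0.
transitivity (P * C y s * C (y + 1) s).
  by rewrite -(mulrA _ (U _)) E mulrBr Cdrop // -(mulrA _ (C y s) (C y s)) Csq mulr0 subr0.
transitivity (P * U (y + 1) * C y s * C y (s - 1)).
  have -> : P * C y s = P * C (y + 1) s - P * U (y + 1) * C y (s - 1).
    by rewrite [C (y + 1) s]Crec addrK mulrDr mulrA addrK.
  rewrite mulrBl -(mulrA P (C _ _)) Csq mulr0 sub0r.
  have -> : C (y + 1) s = C y s + U (y + 1) * C y (s - 1) by rewrite [LHS]Crec addrK.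
  have Z : P * U (y + 1) * C y (s - 1) * (U (y + 1) * C y (s - 1)) = 0.
    transitivity (P * (U (y + 1) * C y (s - 1) * U (y + 1)) * C y (s - 1)); first by rewrite !mulrA.
    by rewrite Csand ?mulr0 ?mul0r //; lia.
  by rewrite mulrDr Z addr0 -(mulrA (P * _)) Canti mulrN mulrA.
rewrite -(Cdrop _ Q1) [C (y - 1) s]Crec mulrDr mulrDl (_ : y - 1 - 1 = y - 2); last by lia.
rewrite mulrA (_ : _ * C (y - 2) (s - 1) = P * U (y + 1) * U (y - 1) * C (y - 1 - 1) (s - 1)).
  by rewrite (Cdrop _ Q3) (Cdrop _ Q2) -(mulrA (_ * U (y - 1))) Csq mulr0 addr0.
by congr (_ * C _ _); lia.
Qed.

(** The right column is expanded by its largest letter x. The left bound is y - 2 = x - 3 for x = y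
    + 1 and y - 1 <= x - 3 for larger x, which is the source of the distance 3 between diagonal
    neighbours. *)
Lemma two_columns P y n s : P * U y = 0 -> y - 1 <= n ->
  P * C (y - 1) s * C n s =
  \sum_(x <- irange (y + 1) n)
    (if x == y + 1 then P * U x * C (y - 2) s * C (x - 1) (s - 1)
     else P * C (y - 1) s * (U x * C (x - 1) (s - 1))).
Proof.
move=> Py yn; rewrite (Ctele s yn) subrK mulrDr -mulrA Csq mulr0 add0r.
have [ny|ny] := ltP n y; first by rewrite !irange_nil ?big_nil ?mulr0 //; lia.
rewrite irange_recl // big_cons mulrDr [X in X + _]mulrA two_columns_eq // add0r mulr_sumr.
apply: eq_big_seq => x; rewrite mem_irange => /andP[yx xn]; case: eqP => [->|//].
by rewrite addrK mulrA two_columns_succ.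
Qed.

Definition wprod (w : seq int) : X := \prod_(x <- w) U x.
(** The columns go from west to east, while [ys] runs from south-east to north-west; above an entry
    y only letters up to y - 1 may follow. *)
Definition cols s ys : X := \prod_(y <- rev ys) C (y - 1) s.

Lemma cols_cons s y ys : cols s (y :: ys) = cols s ys * C (y - 1) s.
Proof. by rewrite /cols rev_cons -cats1 big_cat big_seq1. Qed.

Lemma wprod_comm x w : all (fun a => a + 3 < x) w -> GRing.comm (U x) (wprod w).
Proof.
move=> /allP wx; rewrite /wprod big_seq; apply: commr_prod => a /wx ax.
exact: Ufar.
Qed.

Lemma cols_comm x s ys : all (fun y => y + 2 < x) ys -> GRing.comm (U x) (cols s ys).
Proof.
move=> /allP yx; rewrite /cols big_seq; apply: commr_prod => a.
by rewrite mem_rev => /yx ax; apply: Cfar; lia.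
Qed.

(** Letters below x - 3 commute with u_x, and x - 3 occurs at most once, so what remains is a braid
    relation or u_x^2 = 0. *)
Lemma wprod_sandwich x w : all (fun a => a + 3 <= x) w -> uniq w -> U x * wprod w * U x = 0.
Proof.
elim: w => [|a w IH] /=; first by rewrite /wprod big_nil mulr1 UU.
case/andP => ax aw /andP[nw uw]; rewrite /wprod big_cons -/(wprod w).
have [ax'|ax'] := ltP (a + 3) x.
  by rewrite mulrA (Ufar ax') -!mulrA (mulrA (U x)) IH ?mulr0.
have {ax ax'} ax : x = a + 3 by lia.
rewrite -!mulrA -(@wprod_comm x w); last first.
  apply/allP => b bw; have := allP aw _ bw.
  have : b != a by apply: contraNneq nw => <-.
  by lia.
by rewrite !mulrA ax Ubraid mul0r.
Qed.

Lemma dvals_gaps m0 ys n zs : zs \in dvals m0 ys n -> pairwise (fun z z' => z' + 3 <= z) zs.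
Proof.
elim: ys n zs => [|y ys IH] n zs /=.
  by case/mapP => x _ ->.
case/flattenP => l /mapP[x _ ->] {l} /mapP[zs' zs'v ->] /=; rewrite (IH _ _ zs'v) andbT.
by have [_ _ az] := dvalsP zs'v; apply/allP => z /(allP az); lia.
Qed.

(** This supplies the hypothesis P u_y = 0 for the next diagonal. A tail x precedes letters that are
    at most x - 3, which gives a sandwich; a letter read last is killed by its square. The delicate
    case is a south-east arrow from z to x = z + 3, where the word has to end in z x for the braid
    relation to apply. *)
Lemma dvals_kill m0 m ys n zs : gapped m ys -> zs \in dvals m0 ys n ->
  forall z, z \in zs -> wprod (dword ys zs) * U z = 0.
Proof.
elim: ys n zs => [|y ys IH] n zs.
  move=> _ /mapP[x _ ->] z; rewrite inE => /eqP ->.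
  by rewrite /wprod /= big_seq1 UU.
move=> /= /andP[ym gys] /flattenP[l /mapP[x]]; rewrite mem_irange => /andP[yx xn] -> {l}.
case/mapP => zs' zs'v -> {zs} z.
have [sz' hz az] := dvalsP zs'v.
have pz := dvals_gaps zs'v.
have pw := dword_perm ys zs'.
have uw : uniq (dword ys zs').
  rewrite (perm_uniq pw); apply: pairwise_uniq pz => a; lia.
have aw : all (fun a => a + 3 <= x) (dword ys zs').
  by rewrite (perm_all _ pw); apply: sub_all az => a; lia.
have IH' := IH _ _ gys zs'v.
case: ifP => [tail|ntail]; rewrite inE => /predU1P[->|zz'].
- by rewrite /wprod big_cons wprod_sandwich.
- by rewrite /wprod big_cons -mulrA IH' ?mulr0.
- by rewrite /wprod -cats1 big_cat big_seq1 /= -mulrA UU mulr0.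
- rewrite /wprod -cats1 big_cat big_seq1 /= -/(wprod _).
  have [xz|xz] := ltP (z + 3) x.
    by rewrite -mulrA (Ufar xz) mulrA IH' // mul0r.
  case: zs' sz' hz az pz zs'v {pw uw aw IH'} ntail zz' => [//|z' zs'] sz' hz az pz zs'v ntail.
  rewrite inE => /predU1P[ez|zz']; last first.
    by move: pz hz => /= /andP[/allP/(_ _ zz')]; lia.
  rewrite /= -ez in ntail hz.
  have xE : x = z + 3 by lia.
  have yE : y = z + 1 by lia.
    (* Otherwise [z'] is a tail and y' = z' - 1, against y' + 3 <= y = z' + 1. *)
    have [w ->] : exists w, dword ys (z' :: zs') = rcons w z'.
    case: ys sz' ym {zs'v gys IH} => [|y' ys] sz' ym /=.
      by exists [::]; case: zs' sz' {pz ntail az}.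
    case: ifP => [tail|_]; last by exists (dword ys zs').
    by move: tail ym; lia.
  rewrite /wprod -cats1 big_cat big_seq1 /= -ez xE -!mulrA (mulrA (U z)).
  by rewrite Ubraid' mulr0.
Qed.

(* [Z] and [Z'] stand for what lies to the left of the diagonal before and after it is
   read: 1, or an exhausted column and its leading variable. *)
Section Step.
Variables (m0 n0 s : int) (Z Z' : X) (okP : X -> Prop) (good : nat -> X -> Prop) (K : nat).
Hypothesis (okPU : forall P x, n0 + 4 <= x -> okP P -> okP (P * U x)).
Hypothesis (ZU : forall x, n0 + 3 <= x -> GRing.comm Z (U x)).
Hypothesis (Z'U : forall x, GRing.comm Z' (U x)).
Hypothesis (goodU : forall k x S, good k S -> good k (U x * S)).
Hypothesis (goodC : forall k m S, good k S -> good k.+1 (C m (s - 1) * S)).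
Hypothesis (base : forall P n S, okP P -> n0 <= n -> good K S ->
  P * Z * C n s * S = \sum_(x <- irange m0 n) P * U x * Z' * C (x - 1) (s - 1) * S).

(** Each step expands the easternmost pair of columns and moves the new right column into [S], which
    raises [k] by one; at the north-west end [k] has reached [K], as [base] demands. *)
Lemma diagonal_step ys n P S k :
  gapped (n0 + 3) ys -> (if ys is y :: _ then y - 1 else n0) <= n ->
  (forall y, y \in ys -> P * U y = 0) -> okP P -> good k S -> (k + size ys)%N = K ->
  P * Z * cols s ys * C n s * S =
  \sum_(zs <- dvals m0 ys n) P * wprod (dword ys zs) * Z' * cols (s - 1) zs * S.
Proof.
elim: ys n P S k => [|y ys IH] n P S k.
  move=> _ n0n _ PP gS; rewrite addn0 => kK; rewrite /cols big_nil mulr1 base -?kK //=.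
  by rewrite big_map; apply: eq_bigr => x _; rewrite /wprod !big_seq1.
move=> /= /andP[gy gys] yn Pk PP gS kK.
have Py : P * U y = 0 by apply: Pk; rewrite mem_head.
have yn0 : n0 + 3 <= y.
  by elim: ys y gy gys {IH kK Py yn Pk} => // y' ys IH y gy /= /andP[/IH H /H]; lia.
have ysy : all (fun y' => y' + 3 <= y) ys.
  elim: ys y gy gys {IH kK Py yn Pk yn0} => // y' ys IH y gy /= /andP[/IH H /H] => a.
  by rewrite gy; apply: sub_all a => b; lia.
have Py' : P * Z * cols s ys * U y = 0.
  have cy : GRing.comm (U y) (cols s ys).
    by apply: cols_comm; apply: sub_all ysy => b; lia.
  by rewrite -mulrA -cy mulrA -(mulrA P) ZU // mulrA Py !mul0r.
rewrite cols_cons mulrA two_columns // mulr_suml big_flatten big_map.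
apply: eq_big_seq => x; rewrite mem_irange => /andP[yx xn]; rewrite big_map.
have cx : GRing.comm (U x) (cols s ys).
  by apply: cols_comm; apply: sub_all ysy => b; lia.
have Zx : GRing.comm Z (U x) by apply: ZU; lia.
have kK' : (k.+1 + size ys)%N = K by rewrite -kK addnS.
have Pk' y' : y' \in ys -> P * U y' = 0 by move=> y'ys; apply: Pk; rewrite inE y'ys orbT.
have low n' : y - 2 <= n' -> (if ys is y' :: _ then y' - 1 else n0) <= n'.
  by case: (ys) gy => [|y' ys'] gy; lia.
case: eqP => [xy|xy].
(* For x = y + 1 the letter may be the tail of a north-west arrow, so it is moved to the left of all
   columns and read first. *)
- transitivity (P * U x * Z * cols s ys * C (y - 2) s * (C (x - 1) (s - 1) * S)).
    have E : P * Z * cols s ys * U x = P * U x * Z * cols s ys.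
      by rewrite -mulrA -cx mulrA -(mulrA P) Zx !mulrA.
    by rewrite !mulrA E.
  rewrite (_ : Order.min _ _ = y - 2); last by lia.
  rewrite (IH _ _ _ k.+1) //; first last.
  + exact: goodC.
  + by apply: okPU => //; lia.
  + by move=> y' y'ys; rewrite -mulrA (Ufar _) ?mulrA ?Pk' ?mul0r //; have := allP ysy _ y'ys; lia.
  + exact: low.
  apply: eq_big_seq => zs zsv; rewrite cols_cons.
  have [sz hz az] := dvalsP zsv.
  have -> : wprod (if (x == head 0 zs + 3) && (y == head 0 zs + 2) then x :: dword ys zs
            else rcons (dword ys zs) x) = U x * wprod (dword ys zs).
    case: ifP => [_|nt]; first by rewrite /wprod big_cons.
    (* If x is no tail, the next entry is below x - 3, so u_x commutes with the rest of the word and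
       can be read last. *)
    rewrite wprod_comm; first by rewrite /wprod -cats1 big_cat big_seq1.
    rewrite (perm_all _ (dword_perm _ _)).
    have := dvals_gaps zsv.
    case: zs sz hz az nt {zsv} => [//|z zs] _ /= hz az nt /andP[zz _].
    have hz' : z + 3 < x by lia.
    by rewrite hz' /=; apply: sub_all zz => b; lia.
  by rewrite !mulrA.
- transitivity (P * Z * cols s ys * C (y - 1) s * (U x * (C (x - 1) (s - 1) * S))).
    by rewrite !mulrA.
  rewrite (_ : Order.min _ _ = y - 1); last by lia.
  rewrite (IH _ _ _ k.+1) //; first last.
  + exact/goodU/goodC.
  + by apply: low; lia.
  apply: eq_big_seq => zs zsv; rewrite cols_cons.
  have [sz hz az] := dvalsP zsv.
  (* A tail would need x = y + 1. Here u_x stays to the right of the word and only has to pass the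
     columns of [zs], whose bounds are at most x - 4. *)
  rewrite ifN; last by lia.
  rewrite /wprod -cats1 big_cat big_seq1 /= -/(wprod _).
  have cx' : GRing.comm (U x) (cols (s - 1) zs).
    by apply: cols_comm; apply: sub_all az => b; lia.
  by rewrite !mulrA -(mulrA _ (cols _ zs)) -cx' !mulrA -(mulrA _ Z') Z'U !mulrA.
Qed.
End Step.

End Diagonal.

(** * Lam's relations for k = 3 *)

(* [c] and [c'] play the roles of q^-1 and q. *)
Record lam3 (R : nzRingType) (u : int -> R) (c c' : R) : Prop := Lam3 {
  lam3_cc' : c' * c = 1;
  lam3_c : forall x, GRing.comm c (u x);
  lam3_c' : forall x, GRing.comm c' (u x);
  lam3_uu : forall x, u x * u x = 0;
  lam3_braidl : forall x, u (x + 3) * u x * u (x + 3) = 0;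
  lam3_braidr : forall x, u x * u (x + 3) * u x = 0;
  lam3_far : forall x y, y + 3 < x -> GRing.comm (u x) (u y);
  lam3_near : forall x y, x < y -> y < x + 3 -> u x * u y = c * (u y * u x) }.

Section Lam3Theory.
Variables (R : nzRingType) (u : int -> R) (c c' : R).
Hypothesis H : lam3 u c c'.

Lemma lam3_nearV x y : x < y -> y < x + 3 -> u y * u x = c' * (u x * u y).
Proof. by move=> xy yx; rewrite [u x * _](lam3_near H) // mulrA (lam3_cc' H) mul1r. Qed.

(* Killing the generators below [lo] makes the recursion for C(n, s) hold for all n. *)
Lemma lam3_trunc lo : lam3 (fun x => if lo <= x then u x else 0) c c'.
Proof.
case: H => e1 e2 e3 e4 e5 e6 e7 e8; split=> // [x|x|x|x|x|x y xy|x y xy yx].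
- by case: ifP => _ //; exact: commr0.
- by case: ifP => _ //; exact: commr0.
- by case: ifP => _; rewrite ?mulr0.
- by case: ifP => _; case: ifP => _; rewrite ?mulr0 ?mul0r.
- by case: ifP => _; case: ifP => _; rewrite ?mulr0 ?mul0r.
- by case: ifP => _; case: ifP => _; [exact: e7 | exact: commr0 | apply/commr_sym/commr0..].
- by case: ifP => _; case: ifP => _; rewrite ?mulr0 ?mul0r ?mulr0 //; exact: e8.
Qed.

Lemma lam3_map (X : nzRingType) (f : {rmorphism R -> X}) : lam3 (fun x => f (u x)) (f c) (f c').
Proof.
case: H => e1 e2 e3 e4 e5 e6 e7 e8.
split=> [|x|x|x|x|x|x y xy|x y xy yx]; rewrite /GRing.comm -?rmorphM ?e1 ?e2 ?e3 ?e4 ?e5 ?e6 ?rmorph0 ?rmorph1 //.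
  by rewrite e7.
by rewrite e8.
Qed.

Lemma lam3_zaz a z : a < z -> u z * u a * u z = 0.
Proof.
move=> az; have [zf|zf] := ltP (a + 3) z.
  by rewrite (lam3_far H zf) -mulrA (lam3_uu H) mulr0.
have [->|ne] := eqVneq z (a + 3); first exact: lam3_braidl H _.
by rewrite lam3_nearV ?mulrA -?mulrA ?(lam3_uu H) ?mulr0 //; lia.
Qed.

Lemma lam3_aza a z : a < z -> u a * u z * u a = 0.
Proof.
move=> az; have [zf|zf] := ltP (a + 3) z.
  by rewrite -(lam3_far H zf) -mulrA (lam3_uu H) mulr0.
have [->|ne] := eqVneq z (a + 3); first exact: lam3_braidr H _.
by rewrite (lam3_near H) ?mulrA -?mulrA ?(lam3_uu H) ?mulr0 //; lia.
Qed.

(** Beyond distance 3 the bracket is zero. Otherwise b is within distance 2 of both ends, and the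
    powers of q from passing u_a and u_z cancel. *)
Lemma lam3_mid a b z : a < b -> b < z -> GRing.comm (u a * u z - u z * u a) (u b).
Proof.
move=> ab bz; have [zf|zf] := ltP (a + 3) z.
  by rewrite (lam3_far H zf) subrr /GRing.comm mul0r mulr0.
have ab3 : b < a + 3 by lia.
have bz3 : z < b + 3 by lia.
have cu x : c * u x = u x * c by exact: lam3_c H x.
have cu' x : c' * u x = u x * c' by exact: lam3_c' H x.
have E1 : u z * u a * u b = u b * u z * u a.
  by rewrite -mulrA (lam3_near H ab ab3) [u b * u z](lam3_near H bz bz3) !mulrA cu.
have E2 : u a * u z * u b = u b * u a * u z.
  by rewrite -mulrA (lam3_nearV bz bz3) [u b * u a](lam3_nearV ab ab3) !mulrA cu'.
by rewrite /GRing.comm mulrBl mulrBr E1 E2 !mulrA.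
Qed.

Lemma lam3_kill x y P : x != y -> x - 3 < y -> y < x + 3 -> P * u x = 0 -> P * u y * u x = 0.
Proof.
move=> xy yx1 yx2 Px; rewrite -mulrA; have [lt|lt|e] := ltgtP x y; last by rewrite e eqxx in xy.
  by rewrite lam3_nearV // [c' * _]mulrA (lam3_c' H) -mulrA mulrA Px mul0r.
rewrite (lam3_near H) //; last by lia.
by rewrite [c * _]mulrA (lam3_c H) -mulrA mulrA Px mul0r.
Qed.

Lemma esym_far x L d : all (fun a => a + 3 < x) L -> GRing.comm (u x) (esym u L d).
Proof.
elim: L d => [|a L IH] d /=; first by move=> _; case: eqP => _; [exact: commr1|exact: commr0].
case/andP => ax aL; apply: commrD; first exact: IH.
by apply: commrM; [exact: (lam3_far H) | exact: IH].
Qed.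

(** The leading letter a is moved through u_x, up to a factor when a > x - 3. For a = x - 3 all
    later letters commute with u_x, which leaves the braid u_x u_a u_x. *)
Lemma esym_sandwich x L d : pairwise (fun i j : int => j < i) L -> all (fun a => a < x) L ->
  u x * esym u L d * u x = 0.
Proof.
elim: L d => [|a L IH] d /=.
  by case: eqP => _; rewrite ?mulr1 ?mulr0 ?mul0r ?(lam3_uu H).
case/andP => aL sL /andP[ax axL]; rewrite mulrDr mulrDl IH // add0r.
have [xf|xf] := ltP (a + 3) x.
  by rewrite mulrA (lam3_far H xf) -!mulrA (mulrA (u x)) IH ?mulr0.
have [e|ne] := eqVneq x (a + 3).
  rewrite -!mulrA -(@esym_far x L); last by apply: sub_all aL => b; lia.
  by rewrite !mulrA e (lam3_braidl H) mul0r.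
rewrite mulrA lam3_nearV //; last by lia.
by rewrite -!mulrA (mulrA (u x)) IH ?mulr0.
Qed.

Definition letters (lo n : int) := rev (irange lo n).

Lemma letters_pairwise lo n : pairwise (fun i j : int => j < i) (letters lo n).
Proof.
rewrite /letters; set r := fun i j : int => j < i.
suff : pairwise (fun i j : int => i < j) (irange lo n).
  elim: (irange lo n) => //= a L IH /andP[aL /IH sL]; rewrite rev_cons pairwise_rcons sL.
  by rewrite all_rev aL.
suff pw k i : pairwise (fun i j : int => i < j) [seq lo + j%:Z | j <- iota i k] by exact: pw.
elim: k i => //= k IH i; rewrite IH andbT.
by apply/allP => x /mapP[j]; rewrite mem_iota => ij ->; lia.
Qed.

Lemma esym_letters lo n d : esym u (letters lo n) d = esym u (letters lo (n - 1)) d +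
  (if lo <= n then u n else 0) * esym u (letters lo (n - 1)) (d - 1).
Proof.
case: ifP => ln; first by rewrite {1}/letters irange_recr // rev_rcons.
by rewrite mul0r addr0 /letters !irange_nil //; lia.
Qed.

End Lam3Theory.

Lemma sqr_sum_anticomm (X : nzRingType) (I : Type) (r : seq I) (F : I -> X) :
  (forall i j, F i * F j = - (F j * F i)) -> (forall i, F i * F i = 0) ->
  (\sum_(i <- r) F i) * (\sum_(i <- r) F i) = 0.
Proof.
move=> FF F0; elim: r => [|i r IH]; first by rewrite big_nil mul0r.
rewrite !big_cons mulrDl !mulrDr F0 IH add0r addr0.
suff -> : F i * (\sum_(j <- r) F j) = - ((\sum_(j <- r) F j) * F i) by rewrite addNr.
by rewrite mulr_sumr mulr_suml -sumrN; apply: eq_bigr.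
Qed.

Section Wedge.
Variables (R : nzRingType) (u : int -> R) (c c' : R) (H : lam3 u c c').
Variables (X : nzRingType) (io : {rmorphism R -> X}) (v : nat -> X).
Hypotheses (vC : forall r i, GRing.comm (io r) (v i)) (vv : forall i, v i * v i = 0).
Hypothesis (vA : forall i j, v i * v j = - (v j * v i)).
Variables (l : nat) (lo : int).

Definition wedgeU (x : int) : X := io (if lo <= x then u x else 0).
Definition wedgeC (n s : int) : X := \sum_(i < l) io (esym u (letters lo n) (i%:Z + s)) * v i.
Local Notation U := wedgeU.
Local Notation C := wedgeC.

Let HT := lam3_trunc H lo.
Let HX := lam3_map HT io.

Lemma wedge_vM r r' i j : (io r * v i) * (io r' * v j) = io (r * r') * (v i * v j).
Proof. by rewrite mulrA -(mulrA _ (v i)) -vC mulrA -rmorphM !mulrA. Qed.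

Lemma esym_letters_comm n d d' : GRing.comm (esym u (letters lo n) d) (esym u (letters lo n) d').
Proof.
apply: esym_comm (letters_pairwise _ _); try exact: (lam3_uu H).
- exact: (lam3_zaz H).
- exact: (lam3_aza H).
- exact: (lam3_mid H).
Qed.

Lemma wedgeC_rec n s : C n s = C (n - 1) s + U n * C (n - 1) (s - 1).
Proof.
rewrite /C mulr_sumr -big_split; apply: eq_bigr => i _ /=.
by rewrite esym_letters rmorphD rmorphM mulrDl -mulrA addrA.
Qed.

Lemma wedgeC_sq n s : C n s * C n s = 0.
Proof.
apply: sqr_sum_anticomm => [i j|i]; rewrite !wedge_vM.
  by rewrite vA mulrN esym_letters_comm.
by rewrite vv mulr0.
Qed.

Lemma wedgeC_anti n s s' : C n s * C n s' = - (C n s' * C n s).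
Proof.
rewrite /C mulr_suml [in RHS]mulr_suml -sumrN.
under eq_bigr do rewrite mulr_sumr.
under [in RHS]eq_bigr do rewrite mulr_sumr -sumrN.
rewrite exchange_big /=; apply: eq_bigr => j _; apply: eq_bigr => i _.
by rewrite !wedge_vM vA mulrN esym_letters_comm.
Qed.

Lemma wedgeC_far x n s : n + 3 < x -> GRing.comm (U x) (C n s).
Proof.
move=> nx; apply: commr_sum => i _; apply: commrM; last exact: vC.
rewrite /GRing.comm -!rmorphM; congr (io _); case: ifP => _; last exact/commr_sym/commr0.
apply: (esym_far H); rewrite /letters all_rev; apply/allP => a.
by rewrite mem_irange; lia.
Qed.

Lemma wedgeC_sand x n s : n < x -> U x * C n s * U x = 0.
Proof.
move=> nx; rewrite mulr_sumr mulr_suml big1 // => i _.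
rewrite !mulrA -(mulrA _ (v i)) -vC mulrA -!rmorphM.
case: ifP => _; last by rewrite mulr0 rmorph0 mul0r.
rewrite (esym_sandwich H) ?rmorph0 ?mul0r ?letters_pairwise //.
by rewrite /letters all_rev; apply/allP => a; rewrite mem_irange; lia.
Qed.

Let UU := lam3_uu HX : forall x, U x * U x = 0.
Let Ufar := lam3_far HX : forall x y, y + 3 < x -> GRing.comm (U x) (U y).
Let Ubraid := lam3_braidl HX : forall x, U (x + 3) * U x * U (x + 3) = 0.
Let Ubraid' := lam3_braidr HX : forall x, U x * U (x + 3) * U x = 0.
Let Unear := lam3_kill HX : forall x y P,
  x != y -> x - 3 < y -> y < x + 3 -> P * U x = 0 -> P * U y * U x = 0.

(** For s > 0 all degrees i + s are positive and no letter is left: a column cannot run out of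
    letters before its top cell. *)
Lemma wedgeC_low n s : n < lo -> 0 < s -> C n s = 0.
Proof.
move=> nlo s0; apply: big1 => i _; rewrite /letters irange_nil //=.
by rewrite gt_eqF ?rmorph0 ?mul0r //; lia.
Qed.

Lemma wedge_dword_kill m0 m ys n zs : gapped m ys -> zs \in dvals m0 ys n ->
  forall z, z \in zs -> wprod U (dword ys zs) * U z = 0.
Proof. exact: dvals_kill. Qed.

(** No column has reached the first row yet, so the north-west end of the new diagonal lies in
    column 0 and is bounded below by [lo] alone. *)
Lemma wedge_step_live s ys n P S : 0 < s ->
  gapped lo ys -> (if ys is y :: _ then y - 1 else lo - 1) <= n ->
  (forall y, y \in ys -> P * U y = 0) ->
  P * cols C s ys * C n s * S =
  \sum_(zs <- dvals lo ys n) P * wprod U (dword ys zs) * cols C (s - 1) zs * S.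
Proof.
move=> s0 gys yn Pk.
(* With [lo - 3] for [n0], the gap condition of [diagonal_step] becomes [gapped lo ys]. *)
have := @diagonal_step X U C UU Ufar Unear wedgeC_rec wedgeC_sq wedgeC_anti wedgeC_far wedgeC_sand
  lo (lo - 3) s 1 1 (fun _ => True) (fun _ _ => True) (size ys) _ _ _ _ _ _ ys n P S 0%N.
rewrite !mulr1 => ->//.
- by apply: eq_bigr => zs _; rewrite mulr1.
- by move=> x _; exact/commr_sym/commr1.
- by move=> x; exact/commr_sym/commr1.
- move=> Q m T _ _ _; rewrite mulr1.
  have [ml|ml] := ltP m (lo - 1).
    by rewrite wedgeC_low ?irange_nil ?big_nil ?mulr0 ?mul0r //; lia.
  rewrite (Ctele wedgeC_rec s ml) subrK wedgeC_low ?add0r //; last by lia.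
  rewrite mulr_sumr mulr_suml; apply: eq_bigr => x _.
  by rewrite mulr1 !mulrA.
- by rewrite subrK.
- by move: yn; case: (ys) => [|y ys'] //; lia.
Qed.

Lemma prodv_mem_eq0 j js : j \in js -> v j * \prod_(i <- js) v i = 0.
Proof.
elim: js => // a js IH; rewrite inE big_cons => /predU1P[->|/IH e].
  by rewrite mulrA vv mul0r.
by rewrite mulrA vA mulNr -mulrA e mulr0 oppr0.
Qed.

Lemma prodv_nuniq js : ~~ uniq js -> \prod_(i <- js) v i = 0.
Proof.
elim: js => //= a js IH; rewrite negb_and negbK big_cons => /orP[/prodv_mem_eq0//|/IH ->].
by rewrite mulr0.
Qed.

(* This holds when [S] has degree at least [k] in [v_t, ..., v_(l-1)]. *)
Definition vdeg (t k : nat) (S : X) : Prop := forall js : seq nat,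
  all (fun j => t <= j < l)%N js -> (l - t < size js + k)%N -> \prod_(j <- js) v j * S = 0.

Lemma vdeg0 t S : vdeg t 0 S.
Proof.
move=> js jst; rewrite addn0 => sz; rewrite prodv_nuniq ?mul0r //.
apply/negP => uj; have : (size js <= size (iota t (l - t)))%N.
  apply: uniq_leq_size => // j /(allP jst) /=; rewrite mem_iota; lia.
by rewrite size_iota; lia.
Qed.

Lemma vdegU t k x S : vdeg t k S -> vdeg t k (U x * S).
Proof.
move=> dS js jst sz.
have cx : GRing.comm (U x) (\prod_(j <- js) v j) by apply: commr_prod => j _; exact: vC.
by rewrite mulrA -cx -mulrA dS ?mulr0.
Qed.

(** For s <= -t the terms e_(i+s) v_i with i < t have negative degree and vanish, so the column
    contributes one more variable among v_t, ..., v_(l-1). *)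
Lemma vdegC t k n s S : s <= - t%:Z -> vdeg t k S -> vdeg t k.+1 (C n s * S).
Proof.
move=> st dS js jst sz; rewrite mulr_suml mulr_sumr big1 // => i _.
have [it|ti] := ltnP i t; first by rewrite esym_lt0 ?rmorph0 ?mul0r ?mulr0 //; lia.
have cx r : GRing.comm (io r) (\prod_(j <- js) v j) by apply: commr_prod => j _; exact: vC.
rewrite !mulrA -cx -!mulrA [X in _ * X](_ : _ = 0) ?mulr0 //.
have := dS (rcons js i); rewrite -cats1 big_cat big_seq1 /= mulrA; apply.
  by rewrite all_cat jst /= ti ltn_ord.
by rewrite size_cat addn1 addSn -addnS.
Qed.

(* A column whose cells have all been read contributes only its leading variable: the
   other ones are killed by the columns to its right, for degree reasons. *)
Lemma wedgeC_head t n S : (t < l)%N -> vdeg t.+1 (l - t.+1) S ->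
  C n (- t%:Z) * S = v t * S.
Proof.
move=> tl dS; rewrite /C (bigD1 (Ordinal tl)) //= subrr mulrDl.
rewrite [X in _ + X](_ : _ = 0) ?addr0.
  suff -> : esym u (letters lo n) 0 = 1 by rewrite rmorph1 mul1r.
  by elim: (letters lo n) => //= a L ->; rewrite esym_lt0 ?mulr0 ?addr0.
rewrite mulr_suml big1 // => i; rewrite -val_eqE /= => it.
have [lt|ge] := ltnP i t; first by rewrite esym_lt0 ?rmorph0 ?mul0r //; lia.
rewrite -mulrA; have := dS [:: nat_of_ord i]; rewrite big_seq1 /= ltn_ord => -> //; rewrite ?mulr0 //.
  by lia.
Qed.

(** The top cell of column [d] has been read and contains y. The column serves once more as the left
    one of a pair, which forces the next entry of the first row to exceed y, and only then shrinks
    to [v d]. The count of [k] ensures that the columns to its right fill up v_(d+1), ...,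
    v_(l-1). *)
Lemma wedge_step_dead d y ys n P S k : (d.+2 <= l)%N -> (k + size ys = l - d.+2)%N ->
  vdeg d.+1 k S ->
  gapped (y + 3) ys -> (if ys is y' :: _ then y' - 1 else y) <= n ->
  (forall z, z \in y :: ys -> P * U z = 0) ->
  P * C (y - 1) (- d%:Z) * cols C (- d%:Z) ys * C n (- d%:Z) * S =
  \sum_(zs <- dvals (y + 1) ys n)
     P * wprod U (dword ys zs) * v d * cols C (- d.+1%:Z) zs * S.
Proof.
move=> dl kl dS gys yn Pk.
have sE : - d%:Z - 1 = - d.+1%:Z by lia.
have := @diagonal_step X U C UU Ufar Unear wedgeC_rec wedgeC_sq wedgeC_anti wedgeC_far wedgeC_sand
  (y + 1) y (- d%:Z) (C (y - 1) (- d%:Z)) (v d) (fun Q => Q * U y = 0) (vdeg d.+1) (l - d.+2)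
  _ _ _ _ _ _ ys n P S k.
rewrite sE; apply=> //.
- move=> Q x yx Q0; rewrite -mulrA (Ufar _) ?mulrA ?Q0 ?mul0r //; lia.
- by move=> x yx; apply/commr_sym/wedgeC_far; lia.
- by move=> x; exact/commr_sym/vC.
- by move=> j x T; exact: vdegU.
- by move=> j x T; apply: vdegC.
- move=> Q m T Q0 ym dT.
  have ds x : vdeg d.+1 (l - d.+1) (C x (- d.+1%:Z) * T).
    by rewrite (_ : (l - d.+1 = (l - d.+2).+1)%N); [exact: vdegC | lia].
  rewrite (two_columns UU Unear wedgeC_rec wedgeC_sq wedgeC_anti wedgeC_sand) //; last by lia.
  rewrite mulr_suml sE; apply: eq_bigr => x _.
  case: ifP => _.
    rewrite -!mulrA (wedgeC_head _ _ (ds _)) //; last by lia.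
  have := @wedgeC_head d (y - 1) (U x * (C (x - 1) (- d.+1%:Z) * T)).
  rewrite -!mulrA => ->; [|by lia|exact: vdegU].
  by congr (Q * _); rewrite !mulrA (vC _ d).
- by move=> z zys; apply: Pk; rewrite inE zys orbT.
- exact: Pk (mem_head _ _).
Qed.

End Wedge.

(** * Reading off all diagonals *)

Lemma gapped_rcons m ys y : gapped m (rcons ys y) = gapped (y + 3) ys && (m <= y).
Proof.
elim: ys => [|a ys IH] /=; first by rewrite andbT.
by rewrite IH andbA; case: ys {IH}.
Qed.

Lemma gapped_trans m m' ys : m <= m' -> gapped m' ys -> gapped m ys.
Proof.
move=> mm'; elim: ys => //= y ys IH /andP[h /IH ->]; rewrite andbT.
by case: ys h {IH} => //; exact: le_trans.
Qed.

Lemma gapped_ge m ys : gapped m ys -> all (fun y => m <= y) ys.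
Proof.
elim: ys => //= y ys IH /andP[h /[dup] g /IH a]; rewrite a andbT.
by case: ys h a {g IH} => //= y' ys h /andP[a _]; lia.
Qed.

Lemma dvals_gapped m0 ys n zs : zs \in dvals m0 ys n -> gapped m0 zs.
Proof.
elim: ys n zs => [|y ys IH] n zs /=.
  by case/mapP => x; rewrite mem_irange => /andP[m0x _] -> /=; rewrite m0x.
case/flattenP => l /mapP[x _ ->] {l} /mapP[zs' zs'v ->] /=; rewrite (IH _ _ zs'v) andbT.
by have [sz hz _] := dvalsP zs'v; case: zs' sz hz {zs'v} => //= z zs' _; lia.
Qed.

(* A shape with [N] rows and [l] columns, of lengths [a]; its diagonal of content
   [i - N] meets the columns [c] with [i - N <= c < b i].  The elements of [dtabs i]
   are the fillings of the first diagonals, up to content [i - N], given by the list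
   of these diagonals, last one first. *)
Section Chain.
Variables (N l : nat) (a b : nat -> nat) (lo hi : int).

(** In this case the next diagonal starts at the bottom of a column not met before. *)
Definition grow i := (b i < b i.+1)%N.
(* Keeps the entries of the diagonal [ys] of content [i - N] that have both a north and
   an east neighbour. *)
Definition dtrim i ys : seq int :=
  let ys1 := if grow i then ys else behead ys in
  if (N <= i)%N then take (size ys1).-1 ys1 else ys1.
(** At the bottom of a new column only [hi] bounds the first entry; otherwise the entry below it
    does. The last entry is bounded by its west neighbour once N <= i, and lies in column 0 before
    that. *)
Definition dnext i ys : seq (seq int) :=
  dvals (if (N <= i)%N then last 0 ys + 1 else lo) (dtrim i ys)
        (if grow i then hi else head 0 ys - 1).

Fixpoint dtabs i : seq (seq (seq int)) :=
  if i is i'.+1 then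
    flatten [seq [seq zs :: ts | zs <- dnext i' (head [::] ts)] | ts <- dtabs i']
  else [:: [::]].

Fixpoint dtword i ts : seq int :=
  if i is i'.+1 then
    dtword i' (behead ts) ++ dword (dtrim i' (head [::] (behead ts))) (head [::] ts)
  else [::].

Hypothesis N0 : (0 < N)%N.
Hypothesis lohi : lo <= hi.
Hypothesis b0 : b 0 = 0%N.
Hypothesis bS : forall i, (b i <= b i.+1 <= (b i).+1)%N.
Hypothesis bl : forall i, (b i <= l)%N.
Hypothesis bgrow : forall i, grow i -> (a (b i) + i = b i + N)%N.
Hypothesis bne : forall i, (0 < i)%N -> (i < N + l)%N -> (i - N < b i)%N.
Hypothesis brest : forall i c, (b i <= c)%N -> (c < l)%N -> (a c + i <= c + N)%N.

Lemma size_dtrim i ys : size (dtrim i ys) = (size ys - ~~ grow i - (N <= i))%N.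
Proof.
rewrite /dtrim; case: (grow i); case: (N <= i)%N => /=;
  by rewrite ?size_takel ?leq_pred ?size_behead; lia.
Qed.

Lemma dtabs_inv i ts : (i < N + l)%N -> ts \in dtabs i ->
  [/\ size (head [::] ts) = (b i - (i - N))%N, gapped lo (head [::] ts)
    & all (fun z => z <= hi) (head [::] ts)].
Proof.
elim: i ts => [|i IH] ts iN; first by rewrite inE => /eqP -> /=; rewrite b0.
case/flattenP => L /mapP[ts' ts'i ->] {L} /mapP[zs zsi ->] {ts} /=.
have [szt gt at'] := IH _ (ltnW iN) ts'i.
have [sz _ az] := dvalsP zsi.
have ne := bne (ltn0Sn i) iN.
have bSi := bS i.
have nei : (0 < i)%N -> (i - N < b i)%N by move=> i0; apply: bne => //; exact: ltnW.
split.
- by rewrite sz size_dtrim szt /grow; lia.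
- apply: gapped_trans (dvals_gapped zsi); case: ifP => // Ni.
  suff h : lo <= last 0 (head [::] ts') by apply: le_trans h _; rewrite lerDl.
  have : (0 < size (head [::] ts'))%N by rewrite szt; lia.
  by move: gt; case/lastP: (head _ _) => // ys y; rewrite gapped_rcons last_rcons => /andP[].
- apply: sub_all az => z zn; apply: le_trans zn _; case: ifP => // gi.
  have : (0 < size (head [::] ts'))%N by rewrite szt; move: gi; rewrite /grow; lia.
  by move: at'; case: (head [::] ts') => //= y ys /andP[yh _] _; lia.
Qed.

Section Algebra.
Variables (R : nzRingType) (u : int -> R) (c c' : R) (H : lam3 u c c').
Variables (X : nzRingType) (io : {rmorphism R -> X}) (v : nat -> X).
Hypotheses (vC : forall r i, GRing.comm (io r) (v i)) (vv : forall i, v i * v i = 0).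
Hypothesis (vA : forall i j, v i * v j = - (v j * v i)).

Local Notation U := (wedgeU u io lo).
Local Notation C := (wedgeC u io v l lo).

Definition vprod k : X := \prod_(j <- iota 0 k) v j.
Definition rest i : X := \prod_(k <- iota (b i) (l - b i)) C hi ((a k)%:Z - k%:Z).


Lemma gapped_dtrim i ys : gapped lo ys -> gapped lo (dtrim i ys).
Proof.
have gb ys' : gapped lo ys' -> gapped lo (take (size ys').-1 ys').
  case/lastP: ys' => // ys' y; rewrite gapped_rcons size_rcons -cats1 take_size_cat //.
  by case/andP => g ly; apply: gapped_trans g; lia.
move=> gys; have gys1 : gapped lo (if grow i then ys else behead ys).
  by case: ifP => // _; case: ys gys => //= y ys /andP[].
by rewrite /dtrim; case: (N <= i)%N => //; exact: gb.
Qed.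

Lemma dtabs_kill i ts : (i < N + l)%N -> ts \in dtabs i ->
  forall z, z \in head [::] ts -> wprod U (dtword i ts) * U z = 0.
Proof.
case: i => [|i] iN; first by rewrite inE => /eqP ->.
case/flattenP => L /mapP[ts' ts'i ->] {L} /mapP[zs zsi ->] {ts} z /= zzs.
have [_ gt _] := dtabs_inv (ltnW iN) ts'i.
rewrite /wprod big_cat -!/(wprod _ _) /= -mulrA.
by rewrite (wedge_dword_kill H io lo (gapped_dtrim i gt) zsi) // mulr0.
Qed.

(** The bottom cell of an untouched column [k] lies beyond the diagonal, so a_k - k <= N - i, as
    [vdegC] requires. *)
Lemma vdeg_rest i : (N <= i)%N -> vdeg v l (i - N) (l - b i) (rest i).
Proof.
move=> Ni; rewrite /rest.
have [k kE] : exists k, (l - b i)%N = k by exists (l - b i)%N.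
rewrite kE.
have kl : (b i + k <= l)%N by have := bl i; lia.
elim: k (b i) kl (@brest i) {kE} => [|k IH] m ml Hm; first exact: vdeg0.
rewrite /= big_cons; apply: vdegC => //.
  by have := Hm m (leqnn _); lia.
by apply: IH => [|j mj jl]; [lia | apply: Hm => //; lia].
Qed.

Lemma cols_rcons s ys y : cols C s (rcons ys y) = C (y - 1) s * cols C s ys.
Proof. by rewrite /cols rev_rcons big_cons. Qed.

Lemma rest_grow i : (i < N + l)%N -> grow i -> rest i = C hi (N%:Z - i%:Z) * rest i.+1.
Proof.
move=> iN gi; rewrite /rest; have := bl i.+1; have := bS i; move: (gi); rewrite /grow => g bSi bli.
have -> : (l - b i = (l - b i.+1).+1)%N by lia.
rewrite /= big_cons (_ : (b i).+1 = b i.+1); last by lia.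
by congr (C hi _ * _); have := bgrow gi; lia.
Qed.

Lemma rest_ngrow i : ~~ grow i -> rest i = rest i.+1.
Proof. by rewrite /grow => g; rewrite /rest (_ : b i.+1 = b i) //; have := bS i; lia. Qed.

(** The invariant of the reading. The four factors are the exhausted columns, each reduced to its
    variable, the word read so far, the columns cut by the current diagonal, and the untouched
    ones. *)
Lemma chain i : (i < N + l)%N ->
  \prod_(k <- iota 0 l) C hi ((a k)%:Z - k%:Z) =
  \sum_(ts <- dtabs i) vprod (i - N) * wprod U (dtword i ts) *
     cols C (N%:Z - i%:Z) (head [::] ts) * rest i.
Proof.
elim: i => [|i IH] iN.
  by rewrite big_seq1 /vprod /rest /wprod /cols b0 sub0n subn0 !big_nil !mul1r.
rewrite IH 1?ltnW //= big_flatten big_map; apply: eq_big_seq => ts tsi; rewrite big_map /=.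
have [szt gt at'] := dtabs_inv (ltnW iN) tsi.
have kt := dtabs_kill (ltnW iN) tsi.
have ne := bne (ltn0Sn i) iN.
have bSi := bS i.
have nei : (0 < i)%N -> (i - N < b i)%N by move=> i0; apply: bne => //; exact: ltnW.
move: (head [::] ts) szt gt at' kt => ys szt gt at' kt.
pose n := if grow i then hi else head 0 ys - 1.
pose ys1 := if grow i then ys else behead ys.
(* The column to expand is a new one taken from [rest], or else the one of the first entry of [ys],
   bounded by that entry. *)
have E : cols C (N%:Z - i%:Z) ys * rest i = cols C (N%:Z - i%:Z) ys1 * C n (N%:Z - i%:Z) * rest i.+1.
  rewrite /n /ys1; case: ifP => gi; first by rewrite rest_grow 1?ltnW // mulrA.
  rewrite rest_ngrow ?gi //; congr (_ * _).
  case: (ys) szt => [|y ys'] /= szt; last exact: cols_cons.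
  by move: gi; rewrite /grow; lia.
have n1 : (if ys1 is y :: _ then y else lo - 1) <= n.
  rewrite /n /ys1; case: ifP => gi; first by case: (ys) at' => //= [_|y ys' /andP[yh _]]; lia.
  move: gi; rewrite /grow; case: (ys) szt gt => [|y ys'] /= szt; first by lia.
  by case: ys' {szt} => [|y' ys''] /=; lia.
rewrite -mulrA E [in LHS]mulrA.
have gys1 : gapped lo ys1 by rewrite /ys1; case: ifP => // _; case: (ys) gt => //= y ys' /andP[].
have Pk z : z \in ys1 -> vprod (i - N) * wprod U (dtword i ts) * U z = 0.
  move=> zys; rewrite -mulrA kt ?mulr0 //; move: zys; rewrite /ys1; case: ifP => // _.
  exact: mem_behead.
rewrite mulrA.
(* From i = N on, the current diagonal ends in the first row, at the top of column i - N. *)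
have [Ni|iN'] := leqP N i; last first.
  rewrite (wedge_step_live H vC vv vA) //; [|by lia|by case: (ys1) n1 => //=; lia].
  rewrite /dnext /dtrim leqNgt iN' /= -/ys1 -/n.
  apply: eq_bigr => zs _; rewrite (_ : i.+1 - N = i - N)%N; last by lia.
  rewrite /wprod big_cat -!/(wprod _ _) /= !mulrA; congr (_ * cols _ _ _ * _); by lia.
have sE : N%:Z - i%:Z = - (i - N)%N%:Z by lia.
have ys1n : (0 < size ys1)%N.
  by rewrite /ys1; case: ifP; rewrite /grow ?size_behead; lia.
have lE : last 0 ys = last 0 ys1.
  by move: ys1n; rewrite /ys1; case: ifP => // _; case: (ys) => // y [|y' ys'].
have szys1 : (size ys1 + (l - b i.+1) = l - (i - N).+1)%N.
  rewrite /ys1; case: ifP; rewrite /grow ?size_behead; have := bl i.+1; lia.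
rewrite /dnext /dtrim Ni -/ys1 -/n lE.
case/lastP: ys1 ys1n {lE E} n1 gys1 Pk szys1 => // ys0 y _ n1 gys1 Pk szys1.
rewrite last_rcons size_rcons -cats1 take_size_cat // cats1 cols_rcons sE !mulrA.
rewrite (@wedge_step_dead _ _ _ _ H _ io v vC vv vA l lo _ y ys0 n _ _ (l - b i.+1)); first last.
- by move=> z zy; apply: Pk; rewrite mem_rcons.
- by case: (ys0) n1 => [|y' ys'] /=; lia.
- by move: gys1; rewrite gapped_rcons => /andP[].
- by have := @vdeg_rest i.+1; rewrite (_ : i.+1 - N = (i - N).+1)%N; [apply; lia | lia].
- by move: szys1; rewrite size_rcons; move: (size _) (b _) => p r; lia.
- by move: szys1; rewrite size_rcons; lia.
apply: eq_bigr => zs _; rewrite /wprod big_cat -!/(wprod _ _) /=.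
rewrite (_ : i.+1 - N = (i - N).+1)%N; last by lia.
rewrite {2}/vprod -addn1 iotaD big_cat /= big_seq1 add0n addn1.
rewrite (_ : N%:Z - i.+1%:Z = - (i - N).+1%:Z); last by lia.
have cw w : GRing.comm (v (i - N)) (wprod U w) by apply: commr_prod => x _; exact/commr_sym/vC.
rewrite -/(vprod _) -!mulrA; congr (_ * _).
by rewrite [in RHS]mulrA cw -!mulrA [in RHS](mulrA (v _)) cw !mulrA.
Qed.

End Algebra.

End Chain.

(** * Tableaux as sequences of diagonals *)

Lemma count_iota_prefix (p : pred nat) l c :
  (forall i j, (i <= j)%N -> (j < l)%N -> p j -> p i) -> (c < l)%N ->
  (c < count p (iota 0 l))%N = p c.
Proof.
elim: l c => // l IH c dc cl.
have dc' i j : (i <= j)%N -> (j < l)%N -> p j -> p i by move=> ij jl; apply: dc => //; exact: ltnW.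
rewrite -[in iota 0 _](addn1 l) iotaD count_cat /= addn0 add0n.
have sz : (count p (iota 0 l) <= l)%N by have := count_size p (iota 0 l); rewrite size_iota.
have [pl|npl] := boolP (p l).
  have -> : count p (iota 0 l) = l.
    rewrite -[RHS](size_iota 0 l); apply/eqP; rewrite -all_count; apply/allP => i.
    by rewrite mem_iota => il; apply: (dc i l) => //; lia.
  by rewrite addn1 cl (dc c l).
rewrite addn0; have [cl'|lc] := ltnP c l; first exact: IH.
have -> : c = l by lia.
by rewrite (negbTE npl) ltnNge sz.
Qed.

Section Partition.
Variable lam : seq nat.
Hypothesis lamP : is_partition lam.
Local Notation N := (size lam).
Local Notation l := (head 0%N lam).
Local Notation a := (conj_part lam).

Lemma conj_partE r c : (r < a c)%N = (c < nth 0 lam r)%N.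
Proof.
have /andP[srt _] := lamP.
have E : a c = count (fun i => c < nth 0 lam i)%N (iota 0 N).
  by rewrite /conj_part -[in LHS](mkseq_nth 0%N lam) count_map.
have [rN|Nr] := ltnP r N; last first.
  rewrite nth_default // ltn0 E ltnNge; apply/negbF/(leq_trans (count_size _ _)).
  by rewrite size_iota.
rewrite E count_iota_prefix // => i j ij jN cj; apply: leq_trans cj _.
apply: (sorted_leq_nth (leT := geq)) => //; rewrite ?inE //.
- by move=> n m p /= mn pm; apply: leq_trans pm mn.
- by move=> n /=.
- exact: leq_ltn_trans ij jN.
Qed.

Lemma head_gt0 : (0 < N)%N -> (0 < l)%N.
Proof.
have /andP[_] := lamP; case: (lam) => // x s.
by rewrite inE negb_or /= => /andP[x0 _] _; rewrite lt0n eq_sym.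
Qed.

Lemma conj_part_size c : (a c <= N)%N.
Proof. exact: count_size. Qed.

Lemma conj_part_gt0 c : (c < l)%N -> (0 < a c)%N.
Proof. by move=> cl; rewrite conj_partE nth0. Qed.

Lemma conj_part0 : a 0 = N.
Proof.
have /andP[_ n0] := lamP; rewrite /conj_part; apply/eqP; rewrite -all_count.
by apply/allP => x xl; rewrite lt0n; apply: contraNneq n0 => <-.
Qed.

Lemma conj_part_anti c c' : (c <= c')%N -> (a c' <= a c)%N.
Proof. by move=> cc; apply: sub_count => x /=; exact: leq_ltn_trans. Qed.

(* The diagonal of content [i - N] has a cell in column [c] iff
   [i - N <= c < bcol i]. *)
Definition bcol i := count (fun c => c + N < a c + i)%N (iota 0 l).

Lemma bcolE i c : (c < l)%N -> (c < bcol i)%N = (c + N < a c + i)%N.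
Proof.
apply: count_iota_prefix => j k jk kl; have := conj_part_anti jk; lia.
Qed.

Lemma bcol_le i : (bcol i <= l)%N.
Proof. by rewrite (leq_trans (count_size _ _)) ?size_iota. Qed.

Lemma bcol0 : bcol 0 = 0%N.
Proof.
apply/eqP; rewrite -leqn0 -ltnS ltnNge; apply/negP => h.
have := bcol_le 0 => h'; have : (0 < bcol 0)%N by [].
by rewrite bcolE; [have := conj_part_size 0; lia | lia].
Qed.

Lemma bcolS i : (bcol i <= bcol i.+1 <= (bcol i).+1)%N.
Proof.
apply/andP; split; first by apply: sub_count => c /=; lia.
rewrite leqNgt; apply/negP => h; have := bcol_le i.+1 => h'.
move: (h); rewrite bcolE; last by lia.
have := @bcolE i (bcol i); rewrite ltnn; have := @conj_part_anti (bcol i) (bcol i).+1; lia.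
Qed.

Lemma bcol_grow i : grow bcol i -> (a (bcol i) + i = bcol i + N)%N.
Proof.
rewrite /grow => g; have := bcol_le i.+1 => h'; move: (g); rewrite bcolE; last by lia.
by have := @bcolE i (bcol i); rewrite ltnn; lia.
Qed.

Lemma bcol_ne i : (0 < i)%N -> (i < N + l)%N -> (i - N < bcol i)%N.
Proof.
move=> i0 iN; have l0 : (0 < l)%N.
  by apply: head_gt0; case: (lam) iN => //=; lia.
rewrite bcolE; last by lia.
have [Ni|iN'] := leqP i N; first by rewrite (_ : i - N = 0)%N ?conj_part0; lia.
by have := @conj_part_gt0 (i - N); lia.
Qed.

Lemma bcol_rest i c : (bcol i <= c)%N -> (c < l)%N -> (a c + i <= c + N)%N.
Proof. by move=> ic cl; have := @bcolE i c cl; lia. Qed.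

Definition tabs lo hi := dtabs N bcol lo hi (N + l).-1.
Definition tword ts := dtword N bcol (N + l).-1 ts.

(** The last of the N + l - 1 diagonals is one cell, the top of column l - 1. Its column reduces to
    v_(l-1), so both sides become multiples of v_0 ... v_(l-1), whose coefficient [phi] reads. *)
Lemma lam3_identity (R : nzRingType) (u : int -> R) (c c' : R) (lo hi : int) :
  lam3 u c c' -> lo <= hi -> (0 < N)%N ->
  \sum_(s : 'S_l) (-1) ^+ s *
     \prod_(j < l) esym u (letters lo hi) ((a j)%:Z + (s j)%:Z - j%:Z)
  = \sum_(ts <- tabs lo hi) \prod_(x <- tword ts) (if lo <= x then u x else 0).
Proof.
move=> H lohi N0.
have l0 := head_gt0 N0.
have [X [io [v [phi [vC vv vA phiE]]]]] := exterior_algebra_exists R l.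
rewrite -[LHS]phiE -[RHS]phiE; congr phi.
rewrite -(@prod_sum_wedge X R io v l (fun j i => esym u (letters lo hi) ((a j)%:Z + i%:Z - j%:Z))) //.
have iN : ((N + l).-1 < N + l)%N by lia.
have := chain N0 lohi bcol0 bcolS bcol_le bcol_grow bcol_ne bcol_rest H vC vv vA iN.
have -> : \prod_(k <- iota 0 l) wedgeC u io v l lo hi ((a k)%:Z - k%:Z) =
   \prod_(j < l) \sum_(i < l) io (esym u (letters lo hi) ((a j)%:Z + i%:Z - j%:Z)) * v i.
  rewrite -[l in iota 0 l]subn0 -/(index_iota 0 l) big_mkord; apply: eq_bigr => j _.
  by apply: eq_bigr => i _; congr (io (esym _ _ _) * _); lia.
move=> ->; rewrite rmorph_sum mulr_suml; apply: eq_big_seq => ts tsi.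
have [szt _ _] := dtabs_inv N0 lohi bcol0 bcolS bcol_ne iN tsi.
have bE : bcol (N + l).-1 = l.
  have := @bcol_ne (N + l).-1; have := bcol_le (N + l).-1; lia.
have iE : ((N + l).-1 - N = l.-1)%N by lia.
have sE : N%:Z - (N + l).-1%:Z = - l.-1%:Z by lia.
rewrite /rest bE subnn big_nil mulr1 iE sE /tword.
have wE w : wprod (wedgeU u io lo) w = io (\prod_(x <- w) (if lo <= x then u x else 0)).
  by rewrite /wprod rmorph_prod.
rewrite wE; move: szt; rewrite bE iE.
case: (head [::] ts) => [|y [|y' ys]] /= szt; [lia| |lia].
rewrite /cols /rev /= big_seq1.
have := @wedgeC_head R u X io v l lo l.-1 (y - 1) 1; rewrite !mulr1 => ->; [|by lia|].
  have cio : GRing.comm (io (\prod_(x <- tword ts) (if lo <= x then u x else 0))) (vprod v l.-1).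
    by apply: commr_prod => j _; exact: vC.
  rewrite -cio -mulrA; congr (_ * _).
  rewrite -(big_mkord xpredT v) /index_iota subn0 /vprod -[in iota 0 l](prednK l0).
  by rewrite -addn1 iotaD big_cat /= big_seq1 add0n.
by rewrite prednK // subnn; exact: vdeg0.
Qed.

End Partition.

Lemma iota_rcons m n : iota m n.+1 = rcons (iota m n) (m + n)%N.
Proof. by rewrite -addn1 iotaD cats1. Qed.

(** Diagonals indexed by columns: [z c.+1] is the east neighbour of [y c], and [z c] its north
    neighbour. *)
Lemma dvals_cols m0 n (z y : nat -> int) a k :
  ([seq z c | c <- rev (iota a k.+1)] \in dvals m0 [seq y c | c <- rev (iota a k)] n) <->
  [/\ z (a + k)%N <= n, m0 <= z a & forall c, (a <= c)%N -> (c < a + k)%N ->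
     [/\ y c + 1 <= z c.+1, z c <= y c - 1 & z c + 3 <= z c.+1]].
Proof.
elim: k n => [|k IH] n.
  rewrite addn0 /=; split.
    by case/mapP => x; rewrite mem_irange => /andP[mx xn] [->]; split=> // c; lia.
  by case=> zn mz _; apply: map_f; rewrite mem_irange mz zn.
have rE j : rev (iota a j.+1) = (a + j)%N :: rev (iota a j) by rewrite iota_rcons rev_rcons.
rewrite (rE k.+1) [in dvals _ _ _]rE !map_cons; split.
  case/flattenP => L /mapP[x]; rewrite mem_irange => /andP[yx xn] -> {L} /mapP[zs' zs'v [ex ezs]].
  move: zs'v; rewrite -ezs => /IH[h1 h2 h3]; rewrite ex; split=> // c ac cak.
  have [ck|ck] := ltnP c (a + k); first exact: h3.
  have -> : c = (a + k)%N by lia.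
  by rewrite -addnS ex; split; lia.
case=> zn mz h; have [||h1 h2 h3] := h (a + k)%N; try lia.
apply/flattenP; exists [seq z (a + k.+1)%N :: zs | zs <- dvals m0 [seq y i | i <- rev (iota a k)]
  (Order.min (y (a + k)%N - 1) (z (a + k.+1)%N - 3))].
  by apply: (map_f (fun x => [seq x :: zs | zs <- dvals m0 _ (Order.min (_ - 1) (x - 3))])); rewrite mem_irange zn addnS h1.
apply: map_f; apply/IH; split=> //; first by rewrite addnS; lia.
by move=> c ac ck; apply: h; lia.
Qed.

(** The recursion puts tails in front and other entries at the end, so tails come out in north-west
    order and the rest in south-east order. The cell in column [a] has no north-west neighbour on
    the diagonal. *)
Lemma dword_split (z y : nat -> int) (tail : pred nat) a k : ~~ tail a ->
  (forall c, (a <= c)%N -> (c < a + k)%N -> tail c.+1 = (z c.+1 == z c + 3) && (y c == z c + 2)) ->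
  dword [seq y c | c <- rev (iota a k)] [seq z c | c <- rev (iota a k.+1)] =
  [seq z c | c <- rev [seq c <- iota a k.+1 | tail c] ++ [seq c <- iota a k.+1 | ~~ tail c]].
Proof.
elim: k => [|k IH] ta h; first by rewrite /= (negbTE ta).
have rE j : rev (iota a j.+1) = (a + j)%N :: rev (iota a j) by rewrite iota_rcons rev_rcons.
have dE x y' zs ys : dword (y' :: ys) (x :: zs) =
  if (x == head 0 zs + 3) && (y' == head 0 zs + 2) then x :: dword ys zs
  else rcons (dword ys zs) x by [].
rewrite (rE k.+1) [X in dword X _](_ : _ = y (a + k)%N :: [seq y c | c <- rev (iota a k)]); last by rewrite rE.
rewrite map_cons dE IH //; last by move=> c ac ck; apply: h; lia.
have -> : head 0 [seq z i | i <- rev (iota a k.+1)] = z (a + k)%N by rewrite rE.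
rewrite (iota_rcons a k.+1) !filter_rcons.
rewrite !addnS -h; [|lia|lia].
by case: (tail (a + k).+1); rewrite /negb; [rewrite rev_rcons | rewrite -rcons_cat map_rcons].
Qed.

Section Tableaux.
Variable lam : seq nat.
Hypothesis lamP : is_partition lam.
Local Notation N := (size lam).
Local Notation l := (head 0%N lam).
Local Notation b := (bcol lam).

Definition dcols i := iota (i - N) (b i - (i - N)).
(** With entries indexed by diagonal and column, the cell (i, c) has north neighbour (i + 1, c),
    east neighbour (i + 1, c + 1) and south-east neighbour (i, c + 1). *)
Definition dentries (Z : nat -> nat -> int) i := [seq Z i c | c <- rev (dcols i)].
Fixpoint dtab_of (Z : nat -> nat -> int) i :=
  if i is i'.+1 then dentries Z i :: dtab_of Z i' else [::].

Definition zcell (T : seq (seq int)) i c := entry T (c + N - i) c.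

Lemma dentries0 Z : dentries Z 0 = [::].
Proof. by rewrite /dentries /dcols bcol0 // sub0n. Qed.

Lemma head_dtab_of Z i : head [::] (dtab_of Z i) = dentries Z i.
Proof. by case: i => [|i] //=; rewrite dentries0. Qed.

Lemma mem_dcols i c : (i < N + l)%N -> (c \in dcols i) = (i - N <= c < b i)%N.
Proof. by move=> iN; rewrite mem_iota; have := @bcol_ne lam lamP i; rewrite /bcol; lia. Qed.

Lemma in_shapeE r c : in_shape lam r c = (c < l)%N && (r < conj_part lam c)%N.
Proof.
rewrite conj_partE // /in_shape andb_idl // => cr.
by have := @conj_partE lam lamP 0 c; rewrite nth0 => <-; have := @conj_partE lam lamP r c; lia.
Qed.

Lemma mem_dcols_shape i c : (i - N <= c)%N -> (c < b i)%N -> in_shape lam (c + N - i) c.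
Proof.
move=> ic cb; have cl : (c < l)%N by have := bcol_le lam i; lia.
by rewrite in_shapeE cl /=; move: cb; rewrite bcolE //; lia.
Qed.

Lemma shape_dcols r c : in_shape lam r c ->
  [/\ (c + N - r < N + l)%N, (0 < c + N - r)%N, (c + N - r - N <= c)%N, (c < b (c + N - r))%N
    & (c + N - (c + N - r) = r)%N].
Proof.
rewrite in_shapeE => /andP[cl ra]; have aN := conj_part_size lam c.
by split; rewrite ?bcolE //; lia.
Qed.

Lemma dtrim_dentries Z i : (i.+1 < N + l)%N ->
  dtrim N b i (dentries Z i) =
  [seq Z i c | c <- rev (iota (i.+1 - N) (b i.+1 - (i.+1 - N)).-1)].
Proof.
move=> iN.
have tl (f : nat -> int) m n : behead [seq f c | c <- rev (iota m n)] = [seq f c | c <- rev (iota m n.-1)].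
  by case: n => // n; rewrite iota_rcons rev_rcons.
have bl (f : nat -> int) m n (s := [seq f c | c <- rev (iota m n)]) :
    take (size s).-1 s = [seq f c | c <- rev (iota m.+1 n.-1)].
  rewrite /s; case: n {s} => // n.
  by rewrite [iota m n.+1]/= rev_cons map_rcons size_rcons -cats1 take_size_cat.
have ne := @bcol_ne lam lamP i.+1 (ltn0Sn _) iN.
have bSi := bcolS lamP i.
have ys1E : (if grow b i then dentries Z i else behead (dentries Z i)) =
   [seq Z i c | c <- rev (iota (i - N) (b i.+1 - 1 - (i - N)))].
  rewrite /dentries /dcols; case: ifP; rewrite /grow => g.
    by congr [seq _ | _ <- rev (iota _ _)]; lia.
  by rewrite tl; congr [seq _ | _ <- rev (iota _ _)]; lia.
rewrite /dtrim ys1E; case: ifP => Ni.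
  by rewrite bl; congr [seq _ | _ <- rev (iota _ _)]; lia.
by congr [seq _ | _ <- rev (iota _ _)]; lia.
Qed.

Lemma eq_dtab_of Z Z' i : (i < N + l)%N ->
  (forall j c, (0 < j)%N -> (j <= i)%N -> (j - N <= c)%N -> (c < b j)%N -> Z j c = Z' j c) <->
  dtab_of Z i = dtab_of Z' i.
Proof.
elim: i => [|i IH] iN; first by split=> // _ [].
split=> [h /=|[/eq_in_map e /(IH (ltnW iN)) eZ] j c j0].
  congr (_ :: _); last by apply/(IH (ltnW iN)) => j c j0 ji; apply: h; lia.
  apply/eq_in_map => c; rewrite mem_rev mem_dcols // => /andP[ic cb].
  by apply: h.
rewrite leq_eqVlt => /predU1P[-> jc cb|ji jc cb].
  by apply: e; rewrite mem_rev mem_dcols // jc.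
exact: eZ.
Qed.

Hypothesis N0 : (0 < size lam)%N.

Lemma dtab_of_inj T T' : shape T = lam -> shape T' = lam ->
  dtab_of (zcell T) (N + l).-1 = dtab_of (zcell T') (N + l).-1 -> T = T'.
Proof.
move=> shT shT' /eq_dtab_of e.
have MN : ((N + l).-1 < N + l)%N by lia.
have szT : size T = N by rewrite -shT size_map.
have szT' : size T' = N by rewrite -shT' size_map.
have szr (S : seq (seq int)) r : shape S = lam -> (r < N)%N -> size (nth [::] S r) = nth 0%N lam r.
  by move=> shS; rewrite -[in RHS]shS -shS size_map => rN; rewrite (nth_map [::]).
apply: (@eq_from_nth _ [::]) => [|r]; rewrite szT // => rN.
apply: (@eq_from_nth _ 0) => [|c]; rewrite !szr // => s.
have [h1 h2 h3 h4 h5] := shape_dcols s.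
by have := e MN (c + N - r)%N c h2 _ h3 h4; rewrite /zcell h5; apply; lia.
Qed.

(** Both lists strictly increase in the row index and have the same members. *)
Lemma diagonalE i : (i < N + l)%N ->
  Defs.diagonal lam (i%:Z - N%:Z) = [seq ((c + N - i)%N, c) | c <- dcols i].
Proof.
move=> iN.
pose r (x y : nat * nat) := (x.1 < y.1)%N.
pose r' (x y : nat * nat) := (x.1 < y.1)%N || (x.1 == y.1) && (x.2 < y.2)%N.
have rtr : transitive r by move=> x y z; rewrite /r; exact: ltn_trans.
apply: (@irr_sorted_eq _ r) => //; first by move=> x; rewrite /r ltnn.
- rewrite sorted_pairwise //.
  apply: (@sub_in_pairwise _ (fun x => x.2%:Z - x.1%:Z == i%:Z - N%:Z) r').
    by move=> x y; rewrite !unfold_in /r /r'; lia.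
  + exact: filter_all.
  + apply: pairwise_filter; rewrite /cells.
    suff pw n m : pairwise r' [seq (x, c) | x <- iota m n, c <- iota 0 (nth 0%N lam x)] by exact: pw.
    elim: n m => // n IH m; rewrite [iota m _]/= allpairs_cons pairwise_cat IH andbT; apply/andP; split.
      apply/allrelP => x y /mapP[c _ ->] /allpairsPdep[r0 [c0 [mr _ ->]]].
      by rewrite /r' /=; move: mr; rewrite mem_iota => /andP[-> _].
    rewrite pairwise_map; apply: (@sub_pairwise _ ltn).
      by move=> x y /= xy; rewrite /r' /= eqxx xy orbT.
    by rewrite -sorted_pairwise ?iota_ltn_sorted //; exact: ltn_trans.
- rewrite sorted_pairwise // pairwise_map /dcols.
  apply: (@sub_in_pairwise _ (fun c => i - N <= c)%N ltn).
  + by move=> x y; rewrite !unfold_in /= /r /=; lia.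
  + by apply/allP => c; rewrite mem_iota => /andP[].
  + by rewrite -sorted_pairwise ?iota_ltn_sorted //; exact: ltn_trans.
- move=> [x y]; rewrite mem_filter; apply/andP/mapP => [[/= e /allpairsPdep[x' [y' [xN yx [ex ey]]]]]|[c ci [-> ->]]].
    subst x' y'; have s : in_shape lam x y by move: yx; rewrite mem_iota.
    have xn : (x < N)%N by move: xN; rewrite mem_iota.
    have [h1 h2 h3 h4 h5] := shape_dcols s.
    have iE : i = (y + N - x)%N by lia.
    by exists y; rewrite iE ?h5 // mem_dcols // h3 h4.
  move: ci; rewrite mem_dcols // => /andP[ic cb] /=.
  have s := mem_dcols_shape ic cb; split; first by lia.
  have [h1 h2 h3 h4 h5] := shape_dcols s.
  apply/allpairsPdep; exists (c + N - i)%N, c; split=> //; rewrite mem_iota /=; last exact: s.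
  by move: s; rewrite in_shapeE => /andP[_]; have := conj_part_size lam c; lia.
Qed.

Lemma sqread_dtword T : shape T = lam ->
  sqread T = tword lam (dtab_of (zcell T) (N + l).-1).
Proof.
move=> shT; rewrite /sqread /tword shT /contents.
have: ((N + l).-1 < N + l)%N by lia.
elim: (N + l).-1 => [|i IH] iN //.
rewrite iota_rcons map_rcons map_rcons flatten_rcons IH 1?ltnW //= head_dtab_of //.
congr (_ ++ _); rewrite dtrim_dentries // /dentries.
rewrite /diag_word shT add1n diagonalE //.
have ne := @bcol_ne lam lamP i.+1 (ltn0Sn _) iN.
have kE : (b i.+1 - (i.+1 - N) = (b i.+1 - (i.+1 - N)).-1.+1)%N by lia.
rewrite /dcols kE.
rewrite (@dword_split (zcell T i.+1) (zcell T i) (fun c => nw_tail T ((c + N - i.+1)%N, c))).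
- rewrite !filter_map -map_rev -map_cat -map_comp; apply: eq_map => c /=.
  by [].
- rewrite /nw_tail /=; lia.
- move=> c ac cb; rewrite /nw_tail /= /nw_arrow /zcell.
  have e1 : (c.+1 + N - i.+1)%N = (c + N - i.+1).+1 by lia.
  by rewrite e1 /= (_ : (c + N - i = (c + N - i.+1).+1)%N) //; lia.
Qed.

Variables lo hi : int.
Hypothesis lohi : lo <= hi.

Lemma dentries_dnext Z i : (i.+1 < N + l)%N ->
  (dentries Z i.+1 \in dnext N b lo hi i (dentries Z i)) <->
  [/\ (if grow b i then Z i.+1 (b i.+1).-1 <= hi else Z i.+1 (b i.+1).-1 < Z i (b i).-1),
      (if (N <= i)%N then Z i (i - N)%N < Z i.+1 (i.+1 - N)%N else lo <= Z i.+1 0)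
    & forall c, (i.+1 - N <= c)%N -> (c.+1 < b i.+1)%N ->
     [/\ Z i c < Z i.+1 c.+1, Z i.+1 c < Z i c & Z i.+1 c + 3 <= Z i.+1 c.+1]].
Proof.
move=> iN; have ne := @bcol_ne lam lamP i.+1 (ltn0Sn _) iN.
have bSi := bcolS lamP i.
have nei : (0 < i)%N -> (i - N < b i)%N by move=> i0; apply: bcol_ne => //; exact: ltnW.
rewrite /dnext dtrim_dentries // /dentries /dcols.
have -> : (b i.+1 - (i.+1 - N) = (b i.+1 - (i.+1 - N)).-1.+1)%N by lia.
have kE : (i.+1 - N + (b i.+1 - (i.+1 - N)).-1)%N = (b i.+1).-1 by lia.
have rE m n : (0 < n)%N -> rev (iota m n) = (m + n.-1)%N :: rev (iota m n.-1).
  by case: n => // n _; rewrite iota_rcons rev_rcons.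
have hE : (i - N < b i)%N -> head 0 [seq Z i c | c <- rev (iota (i - N) (b i - (i - N)))] = Z i (b i).-1.
  by move=> h; rewrite rE ?subn_gt0 //=; congr (Z i _); lia.
have lE : (i - N < b i)%N -> last 0 [seq Z i c | c <- rev (iota (i - N) (b i - (i - N)))] = Z i (i - N)%N.
  move=> h; have -> : (b i - (i - N) = (b i - (i - N)).-1.+1)%N by lia.
  by rewrite [iota _ _.+1]/= rev_cons map_rcons last_rcons.
have -> : (if grow b i then Z i.+1 (b i.+1).-1 <= hi else Z i.+1 (b i.+1).-1 < Z i (b i).-1) =
  (Z i.+1 (b i.+1).-1 <= (if grow b i then hi else head 0 [seq Z i c | c <- rev (iota (i - N) (b i - (i - N)))] - 1)).
  by case: ifP; rewrite /grow // => g; rewrite hE; lia.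
have -> : (if (N <= i)%N then Z i (i - N)%N < Z i.+1 (i.+1 - N)%N else lo <= Z i.+1 0) =
  ((if (N <= i)%N then last 0 [seq Z i c | c <- rev (iota (i - N) (b i - (i - N)))] + 1 else lo) <= Z i.+1 (i.+1 - N)%N).
  by case: ifP => Ni; [rewrite lE; lia | rewrite (_ : i.+1 - N = 0)%N //; lia].
apply: (iff_trans (dvals_cols _ _ _ _ _ _)); rewrite kE; split; case=> h1 h2 h3; split=> // c ac cb.
  by have [||*] := h3 c; try lia; split; lia.
by have [||*] := h3 c; try lia; split; lia.
Qed.

Lemma dtab_of_mem Z i : (i < N + l)%N ->
  (dtab_of Z i \in dtabs N b lo hi i) <->
  forall j, (j < i)%N -> dentries Z j.+1 \in dnext N b lo hi j (dentries Z j).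
Proof.
elim: i => [|i IH] iN; first by rewrite /= inE eqxx.
split=> [/= /flattenP[L /mapP[ts tsi ->] {L} /mapP[zs zsi [ezs ets]]] j ji | h].
  move: tsi zsi; rewrite -ezs -ets head_dtab_of => tsi zsi.
  have [ji'|ij] := ltnP j i; first exact: (IH (ltnW iN)).1.
  by have -> : j = i by lia.
apply/flattenP; exists [seq zs :: dtab_of Z i | zs <- dnext N b lo hi i (dentries Z i)].
  rewrite -head_dtab_of; apply: (map_f (fun ts => [seq zs :: ts | zs <- dnext N b lo hi i (head [::] ts)])).
  by apply/(IH (ltnW iN)) => j ji; apply: h; lia.
by apply: map_f; apply: h.
Qed.

Definition bounded T := forall r c, in_shape lam r c -> lo <= entry T r c <= hi.

(** Adjacent cells suffice because a shape contains everything north-west of its cells; the diagonal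
    condition is propagated from the cell (r + 1, c + 1). *)
Lemma rsst_local T : shape T = lam -> (RSST lam T <->
  [/\ forall r c, in_shape lam r c.+1 -> entry T r c < entry T r c.+1,
      forall r c, in_shape lam r.+1 c -> entry T r c < entry T r.+1 c
    & forall r c, in_shape lam r.+1 c.+1 -> entry T r c + 3 <= entry T r.+1 c.+1]).
Proof.
move=> shT; have dn r r' c c' : (r <= r')%N -> (c <= c')%N -> in_shape lam r' c' -> in_shape lam r c.
  rewrite !in_shapeE => rr cc; have := conj_part_anti lam cc; lia.
split=> [[_ hr hc hd]|[hr hc hd]].
  split=> r c s.
  - by apply: hr => //; apply: dn s.
  - by apply: hc => //; apply: dn s.
  - by apply: hd => //; apply: dn s.
have hr' r c c' : in_shape lam r c' -> (c < c')%N -> entry T r c < entry T r c'.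
  move=> s cc; rewrite -(subnKC cc) in s *; elim: (c' - c.+1)%N s => [|k IH] s.
    by rewrite addn0 in s *; exact: hr.
  rewrite addnS in s *; apply: lt_trans (IH _) (hr _ _ s).
  by apply: dn s.
have hc' r r' c : in_shape lam r' c -> (r < r')%N -> entry T r c < entry T r' c.
  move=> s rr; rewrite -(subnKC rr) in s *; elim: (r' - r.+1)%N s => [|k IH] s.
    by rewrite addn0 in s *; exact: hc.
  rewrite addnS in s *; apply: lt_trans (IH _) (hc _ _ s).
  by apply: dn s.
split=> // [r c c' _|r r' c _|r r' c c' _ s rr cc]; [exact: hr'|exact: hc'|].
have s' : in_shape lam r' c.+1 by apply: dn s.
apply: le_trans (hd r c _) _; first exact: dn s.
have h1 : entry T r.+1 c.+1 <= entry T r' c.+1.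
  by move: rr; rewrite leq_eqVlt => /predU1P[->//|rr]; apply/ltW/hc'.
apply: le_trans h1 _.
by move: cc; rewrite leq_eqVlt => /predU1P[->//|cc]; apply/ltW/hr'.
Qed.

(** Only column 0 is compared with [lo] and only column bottoms with [hi]; monotonicity extends the
    bounds to all cells. *)
Lemma dtab_of_rsst T : shape T = lam ->
  (dtab_of (zcell T) (N + l).-1 \in tabs lam lo hi) <-> (RSST lam T /\ bounded T).
Proof.
move=> shT; have MN : ((N + l).-1 < N + l)%N by lia.
split=> [tT | [/(rsst_local shT)[hr hc hd] bT]]; last first.
  apply/(dtab_of_mem _ MN) => i iM; have iN : (i.+1 < N + l)%N by lia.
  have ne := @bcol_ne lam lamP i.+1 (ltn0Sn _) iN.
  have bSi := bcolS lamP i.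
  have sh c : (i.+1 - N <= c)%N -> (c < b i.+1)%N -> in_shape lam (c + N - i.+1) c.
    exact: mem_dcols_shape.
  apply/(dentries_dnext _ iN); rewrite /zcell; split.
  - have s := sh (b i.+1).-1 ltac:(lia) ltac:(lia); case: ifP; rewrite /grow => g.
      by have /andP[] := bT _ _ s.
    have bE : b i.+1 = b i by lia.
    rewrite bE in s *.
    have -> : ((b i).-1 + N - i = ((b i).-1 + N - i.+1).+1)%N by lia.
    apply: hc; rewrite (_ : _.+1 = (b i).-1 + N - i)%N; last by lia.
    by apply: mem_dcols_shape; lia.
  - case: ifP => Ni.
      have -> : (i - N + N - i = i.+1 - N + N - i.+1)%N by lia.
      have -> : (i.+1 - N = (i - N).+1)%N by lia.
      by apply: hr; rewrite -subSn //; apply: sh; lia.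
    by have /andP[] := bT _ _ (sh 0%N ltac:(lia) ltac:(lia)).
  - move=> c ac cb.
    have e1 : (c + N - i = c.+1 + N - i.+1)%N by lia.
    have e2 : (c + N - i = (c + N - i.+1).+1)%N by lia.
    have s1 : in_shape lam (c + N - i) c.+1 by rewrite e1; apply: sh; lia.
    have s2 : in_shape lam (c + N - i) c.
      by move: s1; rewrite /in_shape; exact: ltnW.
    by rewrite -e1 e2; split; [apply: hr|apply: hc|apply: hd]; rewrite -e2.
have hall := (dtab_of_mem _ MN).1 tT.
have loc i : (i.+1 < N + l)%N -> _ := fun iN => (dentries_dnext (zcell T) iN).1 (hall i ltac:(lia)).
have bT : bounded T.
  move=> r c s; have [h1 h2 h3 h4 h5] := shape_dcols s.
  have tj : dtab_of (zcell T) (c + N - r) \in dtabs N b lo hi (c + N - r).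
    by apply/(dtab_of_mem _ h1) => j jr; apply: hall; lia.
  have [_ ga al] := dtabs_inv N0 lohi (bcol0 lamP) (bcolS lamP) (bcol_ne lamP) h1 tj.
  have ca : entry T r c \in head [::] (dtab_of (zcell T) (c + N - r)).
    rewrite head_dtab_of; apply/mapP; exists c; first by rewrite mem_rev mem_dcols ?h3 ?h4.
    by rewrite /zcell h5.
  by rewrite (allP al _ ca) (allP (gapped_ge ga) _ ca).
split=> //; apply/(rsst_local shT); split=> r c s; have [h1 h2 h3 h4 h5] := shape_dcols s.
- have [i iE] : exists i, (c.+1 + N - r)%N = i.+1 by exists (c.+1 + N - r).-1; lia.
  rewrite iE in h1 h2 h3 h4 h5; have [_ g2 g3] := loc i h1.
  have [ca|ca] := leqP (i.+1 - N) c.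
    have [//|g _ _] := g3 c ca; move: g; rewrite /zcell h5.
    by rewrite (_ : c + N - i = r)%N //; lia.
  move: g2; rewrite ifT; last by lia.
  rewrite /zcell (_ : i.+1 - N = c.+1)%N; last by lia.
  have e1 : (i - N = c)%N by lia.
  have e2 : (c + N - i = r)%N by lia.
  by rewrite h5 e1 e2.
- have [i iE] : exists i, (c + N - r)%N = i.+1 by exists (c + N - r).-1; lia.
  have ciE : (c + N - r.+1 = i)%N by lia.
  have [k1 k2 k3 k4 k5] : [/\ (i.+1 < N + l)%N, (c + N - i = r.+1)%N, (c + N - i.+1 = r)%N,
      (i.+1 - N <= c)%N & (c < b i.+1)%N].
    have := bcolS lamP i; move: h1 h2 h3 h4 h5; rewrite ciE => *; split; try lia.
    have : in_shape lam r c.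
      move: s; rewrite !in_shapeE => /andP[-> ra]; lia.
    by move/shape_dcols => [H1 _ _ _ _]; rewrite -iE.
  rewrite ciE in h1 h2 h3 h4 h5; have [g1 _ g3] := loc i k1.
  have [cb|cb] := ltnP c.+1 (b i.+1).
    by have [//|_ g _] := g3 c k4; move: g; rewrite /zcell k2 k3.
  have cE : c = (b i.+1).-1 by lia.
  have bE : (b i.+1 = b i)%N by have := bcolS lamP i; lia.
  move: g1; rewrite ifF; last by rewrite /grow bE ltnn.
  by rewrite -bE -cE /zcell k2 k3.
- have [i iE] : exists i, (c + N - r)%N = i.+1 by exists (c + N - r).-1; lia.
  have ciE : (c.+1 + N - r.+1 = i.+1)%N by lia.
  rewrite ciE in h1 h2 h3 h4 h5; have [_ _ g3] := loc i h1.
  by have [||_ _ g] := g3 c; [lia|lia|]; move: g; rewrite /zcell h5 (_ : c + N - i.+1 = r)%N //; lia.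
Qed.

Lemma dtab_of_exists i ts : (i < N + l)%N -> ts \in dtabs N b lo hi i ->
  exists Z, ts = dtab_of Z i.
Proof.
elim: i ts => [|i IH] ts iN; first by rewrite inE => /eqP ->; exists (fun _ _ => 0).
case/flattenP => L /mapP[ts' ts'i ->] {L} /mapP[zs zsi ->] {ts}.
have sz : size zs = (b i.+1 - (i.+1 - N))%N.
  have : zs :: ts' \in dtabs N b lo hi i.+1.
    apply/flattenP; exists [seq zs :: ts' | zs <- dnext N b lo hi i (head [::] ts')].
      exact: (map_f (fun ts => [seq zs :: ts | zs <- dnext N b lo hi i (head [::] ts)])).
    exact: map_f.
  by case/(dtabs_inv N0 lohi (bcol0 lamP) (bcolS lamP) (bcol_ne lamP) iN) => /= ->.
have [Z ZE] := IH _ (ltnW iN) ts'i.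
(* A diagonal is listed from its easternmost column [b i.+1 - 1] downwards. *)
exists (fun j c => if (j == i.+1)%N then nth 0 zs (b i.+1 - c.+1) else Z j c) => /=.
congr (_ :: _).
  apply: (@eq_from_nth _ 0); first by rewrite size_map size_rev size_iota.
  move=> k kz; rewrite (nth_map 0%N) ?size_rev ?size_iota -?sz // eqxx; congr nth.
  have kb : (k < b i.+1 - (i.+1 - N))%N by rewrite -sz.
  rewrite /dcols nth_rev ?size_iota // nth_iota; last by lia.
  by move: kb; move: (b i.+1) (i.+1 - N)%N => p r; lia.
rewrite ZE; apply/eq_dtab_of; [exact: ltnW | move=> j c _ ji _ _].
by rewrite ifF //; apply/negbTE; lia.
Qed.

Lemma tableau_exists ts : ts \in tabs lam lo hi ->
  exists2 T, ts = dtab_of (zcell T) (N + l).-1 & RSST lam T /\ bounded T.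
Proof.
move=> tsi; have MN : ((N + l).-1 < N + l)%N by lia.
have [Z ZE] := dtab_of_exists MN tsi.
pose T := mkseq (fun r => mkseq (fun c => Z (c + N - r)%N c) (nth 0%N lam r)) N.
have shT : shape T = lam.
  apply: (@eq_from_nth _ 0%N); first by rewrite size_map size_mkseq.
  by move=> r; rewrite size_map size_mkseq => rN; rewrite (nth_map [::]) ?size_mkseq // nth_mkseq // size_mkseq.
have TE r c : in_shape lam r c -> entry T r c = Z (c + N - r)%N c.
  move=> s; have rN : (r < N)%N.
    by rewrite ltnNge; apply/negP => Nr; move: s; rewrite /in_shape nth_default.
  by rewrite /entry nth_mkseq // nth_mkseq.
have E : ts = dtab_of (zcell T) (N + l).-1.
  rewrite ZE; apply/eq_dtab_of => // j c j0 ji jc cb.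
  rewrite /zcell TE; last exact: mem_dcols_shape.
  congr Z; have : (c < l)%N by have := bcol_le lam j; lia.
  by move: cb => /[swap] cl; rewrite bcolE //; have := conj_part_size lam c; lia.
by exists T => //; apply/(dtab_of_rsst shT); rewrite -E.
Qed.

End Tableaux.

(** * The quotient of the free algebra *)

Section TwoSidedQuotient.
Local Open Scope quotient_scope.
Variables (R : nzRingType) (I : zmodClosed R).
Hypothesis IM : forall x a y : R, a \in I -> x * a * y \in I.
Hypothesis I1 : (1 : R) \notin I.

Local Notation Q := (Quotient.quot I).
Let qmul (x y : Q) : Q := \pi_Q (repr x * repr y).

Let pi_eq (x y : R) : (\pi_Q x = \pi_Q y) <-> (x - y \in I).
Proof. by rewrite Quotient.idealrBE; split=> /eqP. Qed.

Let reprB (x : R) : repr (\pi_Q x) - x \in I.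
Proof. by apply/pi_eq; rewrite reprK. Qed.

Let pi_mul (x y : R) : \pi_Q (x * y) = qmul (\pi_Q x) (\pi_Q y).
Proof.
rewrite /qmul; symmetry; apply/pi_eq; set x' := repr _; set y' := repr _.
have -> : x' * y' - x * y = 1 * (x' - x) * y' + x * (y' - y) * 1.
  by rewrite mul1r mulr1 mulrBl mulrBr addrA subrK.
by rewrite rpredD //; apply: IM; exact: reprB.
Qed.

Let pi_add (x y : R) : \pi_Q (x + y) = \pi_Q x + \pi_Q y.
Proof. exact: raddfD. Qed.

Let reprW (P : Q -> Prop) : (forall x, P (\pi_Q x)) -> forall q, P q.
Proof. by move=> h q; rewrite -[q]reprK. Qed.

Let qmulA : associative qmul.
Proof. by elim/reprW=> x; elim/reprW=> y; elim/reprW=> z; rewrite -!pi_mul mulrA. Qed.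
Let qmul1 : left_id (\pi_Q 1) qmul.
Proof. by elim/reprW=> x; rewrite -pi_mul mul1r. Qed.
Let q1mul : right_id (\pi_Q 1) qmul.
Proof. by elim/reprW=> x; rewrite -pi_mul mulr1. Qed.
Let qmulDl : left_distributive qmul +%R.
Proof. by elim/reprW=> x; elim/reprW=> y; elim/reprW=> z; rewrite -pi_add -!pi_mul -pi_add mulrDl. Qed.
Let qmulDr : right_distributive qmul +%R.
Proof. by elim/reprW=> x; elim/reprW=> y; elim/reprW=> z; rewrite -pi_add -!pi_mul -pi_add mulrDr. Qed.
Let q1 : \pi_Q 1 != 0.
Proof.
apply/eqP => e; have /pi_eq : \pi_Q (1 : R) = \pi_Q 0 by rewrite e raddf0.
by rewrite subr0 (negbTE I1).
Qed.

Let S : nzRingType := HB.pack Q (GRing.Zmodule_isNzRing.Build Q qmulA qmul1 q1mul qmulDl qmulDr q1).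

(** [IM] makes the product of representatives well defined on the additive quotient, and [I1] keeps
    1 different from 0. *)
Lemma two_sided_quotient_exists :
  exists (S : nzRingType) (p : {rmorphism R -> S}), forall a, p a = 0 <-> a \in I.
Proof.
pose f : R -> S := \pi_Q.
have fB : zmod_morphism f by move=> x y; exact: (raddfB \pi_Q).
have fM : monoid_morphism f by split=> // x y; exact: pi_mul.
pose fa := GRing.isZmodMorphism.Build R S f fB.
pose fm := GRing.isMonoidMorphism.Build R S f fM.
pose p : {rmorphism R -> S} := HB.pack f fa fm.
exists S, p => a; have := pi_eq a 0; rewrite subr0 => <-.
by rewrite -[\pi_Q 0]/(f 0) -[f 0]/(p 0) rmorph0.
Qed.
End TwoSidedQuotient.

(** * Coefficients of words in the free algebra *)

Definition coefw (x : freealg) : series := fun w => x@_(FMonom w).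

Lemma monE w : mon w = << FMonom w >>.
Proof.
elim: w => [|a w IH].
  by rewrite /mon big_nil; apply/malgP => k; rewrite mcoeff1 mcoeffU1 !fmP fm1 eq_sym.
rewrite /mon big_cons -/(mon w) IH malgM_def fgmulUU mulr1.
by congr << _ >>; apply/eqP; rewrite fmP fmM fmU.
Qed.

Lemma coefw_mon w w' : coefw (mon w) w' = (w' == w)%:R.
Proof. by rewrite /coefw monE mcoeffU1 fmP eq_sym. Qed.

Lemma mon_cat w w' : mon (w ++ w') = mon w * mon w'.
Proof. exact: big_cat. Qed.

Lemma malg_mon (x : freealg) : x = \sum_(k <- msupp x) coefw x k *: mon k.
Proof.
rewrite [LHS]monalgE; apply: eq_bigr => k _; apply/malgP => k'.
by rewrite mcoeffZ monE mcoeffU mcoeffU1 /coefw fmK mulr_natr.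
Qed.

Lemma coefwM x y w : coefw (x * y) w = ser_mul (coefw x) (coefw y) w.
Proof.
have cE (z : freealg) w' : coefw z w' = \sum_(k <- msupp z) z@_k * (k == FMonom w')%:R.
  by rewrite {1}/coefw {1}[z]monalgE raddf_sum; apply: eq_bigr => k _; rewrite /= mcoeffU mulr_natr.
rewrite -[LHS]/((x * y)@_(FMonom w)) mcoeffMl /ser_mul.
under [RHS]eq_bigr do rewrite !cE mulr_suml.
rewrite [RHS]exchange_big /=; apply: eq_bigr => k1 _.
under [RHS]eq_bigr do rewrite mulr_sumr.
rewrite [RHS]exchange_big /=; apply: eq_bigr => k2 _.
have -> : (mmul k1 k2 == FMonom w) = (k1 ++ k2 == w) by rewrite fmP fmM.
have [e|ne] := eqVneq ((k1 : seq int) ++ k2) w.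
  have sz : (size (k1 : seq int) < (size w).+1)%N by rewrite -e size_cat; lia.
  rewrite (bigD1 (Ordinal sz)) //= !fmP /= -{1 2}e take_size_cat // drop_size_cat // !eqxx !mulr1.
  rewrite big1 ?addr0 // => i; rewrite -val_eqE /= => ni.
  rewrite !fmP /=; case: eqP => [e1|]; last by rewrite !mulr0 mul0r.
  by move: ni; rewrite e1 size_takel ?eqxx // -ltnS.
rewrite mulr0n big1 // => i _; rewrite !fmP /=.
case: eqP => [e1|_]; last by rewrite mulr0 mul0r.
case: eqP => [e2|_]; last by rewrite !mulr0.
by move: ne; rewrite e1 e2 cat_take_drop eqxx.
Qed.

Lemma subseq_decreasing (w L : seq int) : pairwise (fun i j : int => j < i) L ->
  {subset w <= L} -> subseq w L = sorted (fun i j : int => j < i) w.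
Proof.
have tr : transitive (fun i j : int => j < i) by move=> x y z /= h1 h2; exact: lt_trans h2 h1.
rewrite -sorted_pairwise // => sL wL; apply/idP/idP => [/subseq_sorted|sw]; first exact.
suff -> : w = filter (mem w) L by exact: filter_subseq.
apply: (irr_sorted_eq tr) => //; first exact: sorted_filter.
by move=> x; rewrite mem_filter andb_idr //; exact: wL.
Qed.

Lemma coefw_esym L d w : pairwise (fun i j : int => j < i) L ->
  coefw (esym u L d) w = (((size w)%:Z == d) && subseq w L)%:R.
Proof.
elim: L d w => [|x L IH] d w /=.
  move=> _; rewrite /coefw; case: eqP => [->|ne].
    rewrite mcoeff1; case: w => [|a w] /=; last by rewrite fmP fm1.
    by rewrite fmP fm1.
  by rewrite mcoeff0; case: w => [|a w] /=; rewrite ?andbF // andbT; case: eqP ne => // <-.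
case/andP => xL sL; rewrite /coefw mcoeffD -!/(coefw _ _) IH //.
have -> : coefw (u x * esym u L (d - 1)) w =
  if w is a :: w' then (a == x)%:R * coefw (esym u L (d - 1)) w' else 0.
  rewrite coefwM /ser_mul.
  have ux w' : coefw (u x) w' = (w' == [:: x])%:R.
    by rewrite -coefw_mon /mon big_seq1.
  case: w => [|a w]; first by rewrite big_ord_recl big_ord0 /= ux mul0r addr0.
  rewrite big_ord_recl ux mul0r add0r big_ord_recl /= ux take0 drop0 eqseq_cons eqxx andbT.
  rewrite big1 ?addr0 // => i _; rewrite ux.
  case: w i => [|b w] i; first by case: i.
  by rewrite /= eqseq_cons andbF mul0r.
case: w => [|a w] /=; first by rewrite addr0 sub0seq.
rewrite IH //; have [->|ne] := eqVneq a x.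
  rewrite (_ : subseq (x :: w) L = false) ?andbF ?add0r ?mul1r.
    by congr (_ && _)%:R; lia.
  apply/negP => /mem_subseq /(_ x (mem_head _ _)) /(allP xL); rewrite ltxx.
  by [].
by rewrite mul0r addr0.
Qed.

(** * Replacing formal series by elements of the free algebra *)

Section Agree.
Variables lo hi : int.

Definition within (w : seq int) := all (fun x => lo <= x <= hi) w.
(** The series have infinitely many terms; over a finite interval of letters an element of the free
    algebra can stand in for them, compatibly with products since factors of a word use only its
    letters. *)
Definition agree (f : series) (F : freealg) := forall w, within w -> f w = coefw F w.

Lemma agree_mul f g F G : agree f F -> agree g G -> agree (ser_mul f g) (F * G).
Proof.
move=> fF gG w ww; rewrite coefwM; apply: eq_bigr => i _.
have : within (take i w ++ drop i w) by rewrite cat_take_drop.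
by rewrite /within all_cat => /andP[wt wd]; rewrite fF // gG.
Qed.

Lemma agree_e d : agree (e d predT) (esym u (letters lo hi) d).
Proof.
move=> w ww; rewrite coefw_esym ?letters_pairwise // /e all_predT andbT.
rewrite subseq_decreasing ?letters_pairwise // => x xw.
by rewrite /letters mem_rev mem_irange; exact: (allP ww).
Qed.

Lemma agree_J l (a : 'I_l -> nat) : agree (J a (fun _ => predT))
  (\sum_(s : 'S_l) (-1) ^+ s * \prod_(j < l) esym u (letters lo hi) ((a j)%:Z + (s j)%:Z - j%:Z)).
Proof.
move=> w ww; rewrite /J /coefw raddf_sum; apply: eq_bigr => s _ /=.
rewrite !mulr_sign.
suff -> : (\big[ser_mul/ser_mon [::]]_(j < l) e ((a j)%:Z + (s j)%:Z - j%:Z) predT) w =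
   coefw (\prod_(j < l) esym u (letters lo hi) ((a j)%:Z + (s j)%:Z - j%:Z)) w.
  by case: (odd_perm s); rewrite ?mcoeffN.
suff : agree (\big[ser_mul/ser_mon [::]]_(j < l) e ((a j)%:Z + (s j)%:Z - j%:Z) predT)
   (\prod_(j < l) esym u (letters lo hi) ((a j)%:Z + (s j)%:Z - j%:Z)) by apply.
elim/big_rec2: _ => [w' _|j F f _ IH]; last exact: agree_mul (agree_e _) IH.
have -> : 1 = mon [::] by rewrite /mon big_nil.
by rewrite coefw_mon.
Qed.
End Agree.

Lemma dvals_uniq m0 ys n : uniq (dvals m0 ys n).
Proof.
elim: ys n => [|y ys IH] n /=; first by rewrite map_inj_uniq ?irange_uniq // => a b [].
apply: allpairs_uniq_dep => [|x _|]; [exact: irange_uniq|exact: IH|].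
by move=> [x1 z1] [x2 z2] _ _ /= [-> ->].
Qed.

Lemma dtabs_uniq N b lo hi i : uniq (dtabs N b lo hi i).
Proof.
elim: i => //= i IH; apply: allpairs_uniq_dep => // [ts _|]; first exact: dvals_uniq.
by move=> [x1 z1] [x2 z2] _ _ /= [-> ->].
Qed.

(** Every entry of T occurs in [sqread T], so a tableau contributing to a word over [lo, hi] has its
    entries there and comes from exactly one member of [tabs]. *)
Lemma agree_RSST lam lo hi : is_partition lam -> (0 < size lam)%N -> lo <= hi ->
  agree lo hi (RSST_sum lam) (\sum_(ts <- tabs lam lo hi) mon (tword lam ts)).
Proof.
move=> lamP N0 lohi w ww; rewrite /coefw raddf_sum /= /RSST_sum.
have [tof tofP] : {tof & forall ts, ts \in tabs lam lo hi ->
   [/\ ts = dtab_of lam (zcell lam (tof ts)) (size lam + head 0%N lam).-1, RSST lam (tof ts) &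
       bounded lam lo hi (tof ts)]}.
  apply: (@choice _ _ (fun ts T => ts \in tabs lam lo hi ->
   [/\ ts = dtab_of lam (zcell lam T) (size lam + head 0%N lam).-1, RSST lam T & bounded lam lo hi T])) => ts.
  have [tsi|] := boolP (ts \in _); last by exists [::].
  by have [T E [RT bT]] := tableau_exists lamP N0 lohi tsi; exists T.
set L := [seq tof ts | ts <- tabs lam lo hi].
have uL : uniq L.
  rewrite map_inj_in_uniq ?dtabs_uniq // => ts ts' /tofP[e1 _ _] /tofP[e2 _ _] e.
  by rewrite e1 e2 e.
rewrite (fsbigE L) //; first last.
- move=> T RT TL; rewrite /ser_mon; case: eqP => // wT; case/negP: TL.
  have [shT _ _ _] := RT.
  have bT : bounded lam lo hi T.
    move=> r c; rewrite -shT => s.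
    have rT : (r < size T)%N.
      by rewrite ltnNge; apply/negP => Tr; move: s; rewrite /in_shape nth_default // size_map.
    have : entry T r c \in sqread T.
      apply: mem_sqread; first by rewrite shT.
      apply/flattenP; exists (nth [::] T r); first exact: mem_nth.
      by apply: mem_nth; move: s; rewrite /in_shape (nth_map [::]).
    by rewrite -wT => /(allP ww).
  have ti := (dtab_of_rsst lamP N0 lohi shT).2 (conj RT bT).
  apply/mapP; exists (dtab_of lam (zcell lam T) (size lam + head 0%N lam).-1) => //.
  have [e1 [shT' _ _ _] _] := tofP _ ti.
  exact: dtab_of_inj e1.
- by move=> T /= /mapP[ts /tofP[_ RT _] ->].
rewrite big_map big_mkcond /=; apply: eq_big_seq => ts /tofP[e1 RT _].
rewrite ifT; last by rewrite inE.
rewrite -/(coefw _ _) coefw_mon /ser_mon.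
by have [shT _ _ _] := RT; rewrite (sqread_dtword lamP N0 shT) -e1.
Qed.

(** * Homogeneity of the ideal and its quotient *)

Local Notation ideal := (two_sided_ideal (lam_rel 3)).

Lemma ideal_Z c a : ideal a -> ideal (c *: a).
Proof. by move=> h; rewrite -mul_malgC -[_ * a]mulr1; exact: ideal_M. Qed.

Lemma ideal_N a : ideal a -> ideal (- a).
Proof. by rewrite -scaleN1r; exact: ideal_Z. Qed.

Definition content_part (s : seq int) (x : freealg) : freealg := ser_part s (coefw x).

Lemma content_part_is_linear s : linear (content_part s).
Proof.
move=> c x y; rewrite /content_part /ser_part scaler_sumr -big_split; apply: eq_bigr => w _ /=.
by rewrite /coefw mcoeffD mcoeffZ scalerDl scalerA.
Qed.
HB.instance Definition _ s := GRing.isLinear.Build laurent freealg freealg *:%R (content_part s) (content_part_is_linear s).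

Lemma content_partD s x y : content_part s (x + y) = content_part s x + content_part s y.
Proof. exact: linearD. Qed.

Lemma content_part_mon s w : content_part s (mon w) = if perm_eq w s then mon w else 0.
Proof.
rewrite /content_part /ser_part.
under eq_bigr do rewrite coefw_mon.
case: ifP => ws.
  rewrite (bigD1_seq w) ?permutations_uniq ?mem_permutations //= eqxx scale1r big1 ?addr0 // => w' ne.
  by rewrite (negbTE ne) scale0r.
rewrite big_seq big1 // => w'; rewrite mem_permutations; case: eqP => [->|]; rewrite ?ws ?scale0r //.
Qed.

Lemma content_part_gen s a : lam_rel 3 a -> ideal (content_part s a).
Proof.
have uu i j : u i * u j = mon [:: i; j] by rewrite /mon !big_cons big_nil mulr1.
have uuu i j k : u i * u j * u k = mon [:: i; j; k] by rewrite /mon !big_cons big_nil mulr1 mulrA.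
move=> ra; suff : content_part s a = a \/ content_part s a = 0.
  by case=> ->; [exact: ideal_gen | exact: ideal_0].
have pC (i j : int) : perm_eq [:: i; j] s = perm_eq [:: j; i] s.
  exact: (perm_catC [:: i] [:: j]).
case: ra => [i|i|i|i j _|i j _ _]; rewrite ?uuu ?uu ?linearB ?linearZ /= !content_part_mon.
- by case: ifP; [left|right].
- by case: ifP; [left|right].
- by case: ifP; [left|right].
- by rewrite pC; case: ifP; [left|right]; rewrite ?subr0.
- by rewrite pC; case: ifP; [left|right]; rewrite ?oppr0 ?scaler0 ?addr0.
Qed.

Lemma malgC_comm (c : laurent) (x : freealg) : x * c%:MP = c *: x.
Proof.
by rewrite malgM_def malgZ_def fgmulgU; apply: eq_bigr => k _; rewrite mulm1 mulrC.
Qed.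

Lemma malg_scalerAr (c : laurent) (x y : freealg) : x * (c *: y) = c *: (x * y).
Proof. by rewrite -mul_malgC mulrA malgC_comm scalerAl. Qed.

Lemma malg_mon_ind (P : freealg -> Prop) : P 0 -> (forall x y, P x -> P y -> P (x + y)) ->
  (forall c w, P (c *: mon w)) -> forall x, P x.
Proof. by move=> P0 PD PZ x; rewrite (malg_mon x); apply: big_ind. Qed.

Lemma morph_mon_eq (f g : freealg -> freealg) : f 0 = 0 -> g 0 = 0 ->
  {morph f : a b / a + b} -> {morph g : a b / a + b} ->
  (forall c w, f (c *: mon w) = g (c *: mon w)) -> f =1 g.
Proof.
move=> f0 g0 fD gD fg x; elim/malg_mon_ind: x => [|x y ex ey|//]; first by rewrite f0 g0.
by rewrite fD gD ex ey.
Qed.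

(** The identity in the quotient concerns all words over [lo, hi] at once, the claim a single
    multiset. For words k and k', the part of k b k' of content [s] is k b' k', where b' is the part
    of b of complementary content, or 0 if there is none. *)
Lemma content_part_ideal a s : ideal a -> ideal (content_part s a).
Proof.
move=> ia; elim: ia s => [b gb||b c _ IHb _ IHc|x b y ib IH] s.
- exact: content_part_gen.
- by rewrite linear0; exact: ideal_0.
- by rewrite linearD; apply: ideal_D; [exact: IHb|exact: IHc].
elim/malg_mon_ind: x => [|x x' hx hx'|c k].
- by rewrite !mul0r linear0; exact: ideal_0.
- rewrite (mulrDl x) (mulrDl (x * b)) linearD; exact: ideal_D hx hx'.
elim/malg_mon_ind: y => [|y y' hy hy'|c' k'].
- by rewrite mulr0 linear0; exact: ideal_0.
- rewrite (mulrDr _ y) linearD; exact: ideal_D hy hy'.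
rewrite malg_scalerAr -!scalerAl !linearZ /=; apply/ideal_Z/ideal_Z.
have [[s' ss']|no] := pselect (exists s', perm_eq (k ++ k' ++ s') s).
  suff -> : content_part s (mon k * b * mon k') = mon k * content_part s' b * mon k'.
    exact: ideal_M.
  apply: (@morph_mon_eq (fun b => content_part s (mon k * b * mon k'))
                        (fun b => mon k * content_part s' b * mon k')) => [|||d d'|c2 w].
  - by rewrite mulr0 mul0r linear0.
  - by rewrite linear0 mulr0 mul0r.
  - move=> d d'; rewrite (mulrDr (mon k) d) (mulrDl (mon k * d)).
    by rewrite (content_partD s (mon k * d * mon k')).
  - rewrite (content_partD s' d) (mulrDr (mon k) (content_part s' d)).
    by rewrite (mulrDl (mon k * content_part s' d)).
  rewrite malg_scalerAr -scalerAl !linearZ /= malg_scalerAr -scalerAl; congr (_ *: _).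
  rewrite -!mon_cat !content_part_mon.
  have -> : perm_eq ((k ++ w) ++ k') s = perm_eq w s'.
    by rewrite -(permPr ss') -catA perm_cat2l perm_catC perm_cat2l.
  by case: ifP => _; rewrite ?mulr0 ?mul0r // !mon_cat.
suff -> : content_part s (mon k * b * mon k') = 0 by exact: ideal_0.
apply: (@morph_mon_eq (fun b => content_part s (mon k * b * mon k')) (fun=> 0)) => [|//|d d'|d d'|c2 w].
- by rewrite mulr0 mul0r linear0.
- rewrite (mulrDr (mon k) d) (mulrDl (mon k * d)).
  by rewrite (content_partD s (mon k * d * mon k')).
- by rewrite addr0.
rewrite malg_scalerAr -scalerAl linearZ /= -!mon_cat content_part_mon ifF ?scaler0 //.
apply/negP => pw; apply: no; exists w; apply: perm_trans pw.
by rewrite -catA perm_cat2l perm_catC.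
Qed.

Definition lam_ideal : {pred freealg} := fun a => `[< ideal a >].

Lemma lam_idealP a : reflect (ideal a) (a \in lam_ideal).
Proof. exact: asboolP. Qed.

Lemma lam_ideal_zmod_closed : zmod_closed lam_ideal.
Proof.
split=> [|a b /lam_idealP ia /lam_idealP ib]; apply/lam_idealP; first exact: ideal_0.
by apply: ideal_D ia (ideal_N ib).
Qed.
HB.instance Definition _ := GRing.isZmodClosed.Build freealg lam_ideal lam_ideal_zmod_closed.

(** All relations have positive degree, so the coefficient of the empty word vanishes on the
    ideal. *)
Lemma lam_ideal_proper : (1 : freealg) \notin lam_ideal.
Proof.
apply/lam_idealP => i1; suff h a : ideal a -> coefw a [::] = 0.
  have := h _ i1; have -> : 1 = mon [::] by rewrite /mon big_nil.
  by rewrite coefw_mon => /eqP; rewrite oner_eq0.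
elim=> [b gb||b c _ IHb _ IHc|x b y _ IH].
- have uu i j : u i * u j = mon [:: i; j] by rewrite /mon !big_cons big_nil mulr1.
  have uuu i j k : u i * u j * u k = mon [:: i; j; k] by rewrite /mon !big_cons big_nil mulr1 mulrA.
  case: gb => [i|i|i|i j _|i j _ _]; rewrite ?uuu ?uu /coefw ?mcoeffB ?mcoeffZ -!/(coefw _ _) !coefw_mon //.
  + by rewrite subr0.
  + by rewrite mulr0 subr0.
- exact: mcoeff0.
- by rewrite /coefw mcoeffD -!/(coefw _ _) IHb IHc addr0.
- by rewrite !coefwM /ser_mul !big_ord_recl !big_ord0 /= coefwM /ser_mul big_ord_recl big_ord0 /= IH mulr0 !addr0 mul0r.
Qed.

Lemma lam_quotient_exists : exists (S : nzRingType) (p : {rmorphism freealg -> S}) (c c' : S),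
  lam3 (fun i => p (u i)) c c' /\ forall a b, p a = p b -> lam_eq 3 a b.
Proof.
have IM (x a y : freealg) : a \in lam_ideal -> x * a * y \in lam_ideal.
  by move=> /lam_idealP ia; apply/lam_idealP/ideal_M.
have [S [p pE]] := two_sided_quotient_exists IM lam_ideal_proper.
exists S, p, (p qV%:MP), (p q%:MP); split; last first.
  move=> a b e; apply/lam_idealP/pE; rewrite rmorphB /= e subrr.
  by [].
have rel a : lam_rel 3 a -> p a = 0 by move=> ra; apply/pE/lam_idealP/ideal_gen.
have cE (c : laurent) x : p c%:MP * p x = p x * p c%:MP.
  by rewrite -!rmorphM mul_malgC malgC_comm.
split=> [|x|x|x|x|x|x y xy|x y xy yx].
- by rewrite -rmorphM -mpolyCM qVK rmorph1.
- exact: cE.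
- exact: cE.
- by rewrite -rmorphM; exact/rel/lam_sqr.
- by rewrite -!rmorphM; exact/rel/(lam_braidl 3).
- by rewrite -!rmorphM; exact/rel/(lam_braidr 3).
- rewrite /GRing.comm -!rmorphM; apply/eqP; rewrite -subr_eq0 -rmorphB.
  by apply/eqP/rel/lam_far; lia.
- rewrite -!rmorphM mul_malgC; apply/eqP; rewrite -subr_eq0 -rmorphB.
  by apply/eqP/rel/lam_near; lia.
Qed.

Lemma rmorph_esym (R S : nzRingType) (p : {rmorphism R -> S}) (x : int -> R) L d :
  p (esym x L d) = esym (fun i => p (x i)) L d.
Proof.
elim: L d => [|a L IH] d /=; first by rewrite rmorph_nat.
by rewrite rmorphD rmorphM !IH.
Qed.

Lemma within_exists (s : seq int) : exists lo hi, lo <= hi /\ within lo hi s.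
Proof.
elim: s => [|a s [lo [hi [lohi ws]]]]; first by exists 0, 0.
exists (Order.min lo a), (Order.max hi a); split; first by lia.
apply/andP; split; first by lia.
by apply: sub_all ws => x; lia.
Qed.

(** With this, killing the letters below [lo] in [lam3_identity] does not affect the words of the
    tableaux. *)
Lemma tword_ge lam lo hi ts x : is_partition lam -> (0 < size lam)%N -> lo <= hi ->
  ts \in tabs lam lo hi -> x \in tword lam ts -> lo <= x.
Proof.
move=> lamP N0 lohi; rewrite /tabs /tword.
have: ((size lam + head 0%N lam).-1 < size lam + head 0%N lam)%N by lia.
elim: (_.-1) ts => [|i IH] ts iN //.
move=> tsi; have [_ g _] := dtabs_inv N0 lohi (bcol0 lamP) (bcolS lamP) (bcol_ne lamP) iN tsi.
move: tsi g => /flattenP[L /mapP[ts' ts'i ->] {L} /mapP[zs zsi ->]] /= g.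
rewrite mem_cat => /orP[|]; first exact: (IH _ (ltnW iN)).
by rewrite (perm_mem (dword_perm _ _)) => /(allP (gapped_ge g)).
Qed.

(** The empty shape has no last diagonal to end the reading with; here both sides are the empty
    word. *)
Lemma frakJ_nil w : frakJ [::] w = RSST_sum [::] w.
Proof.
rewrite /frakJ /J /RSST_sum.
rewrite (_ : RSST [::] = [set [::]]%classic); last first.
  apply/seteqP; split=> [T [/eqP]|T ->] /=; first by case: T.
  have nf r c : in_shape [::] r c = false by rewrite /in_shape nth_nil.
  by split=> [|r c c'|r r' c|r r' c c'] //; rewrite nf.
rewrite fsbig_set1 (big_pred1 1%g) ?odd_perm1 ?expr0 ?mul1r ?big_ord0 //.
by move=> s; rewrite /= (_ : s = 1%g) ?eqxx //; apply/permP => -[].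
Qed.

Theorem theorem1p1 (lam : seq nat) (hlam : is_partition lam) :
  ser_lam_eq 3 (frakJ lam) (RSST_sum lam).
Proof.
move=> s; case: (posnP (size lam)) => [/size0nil ->|N0].
  rewrite /lam_eq (_ : ser_part s _ = ser_part s (RSST_sum [::])) ?subrr; first exact: ideal_0.
  by apply: eq_bigr => w _; rewrite frakJ_nil.
have [lo [hi [lohi ws]]] := within_exists s.
have agree_part f F : agree lo hi f F -> ser_part s f = content_part s F.
  move=> fF; apply: eq_big_seq => w; rewrite mem_permutations => sw.
  by rewrite fF // /within (perm_all _ sw).
rewrite (agree_part _ _ (@agree_J lo hi _ _)) (agree_part _ _ (agree_RSST hlam N0 lohi)).
rewrite /lam_eq -linearB; apply: content_part_ideal.
have [S [p [c [c' [H pI]]]]] := lam_quotient_exists.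
apply: pI; have := lam3_identity hlam H lohi N0.
rewrite !rmorph_sum /= => E; apply: etrans (etrans E _).
  apply: eq_bigr => t _; rewrite rmorphM rmorph_sign rmorph_prod; congr (_ * _).
  by apply: eq_bigr => j _; rewrite rmorph_esym.
apply: eq_big_seq => ts tsi; rewrite /mon rmorph_prod; apply: eq_big_seq => x xt.
rewrite ifT //; exact: (tword_ge hlam N0 lohi tsi xt).
Qed.
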